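(* Let $M\in\mathcal{M}^{n,d}_{\mathrm{rch}_{\min}}$, and assume there exist $0\le\eta\le\Lambda<\mathrm{rch}_{\min}$ and $0\le\theta<\pi/2$ such that: (i) $\mathrm{d}(\hat x_0,M)\le\eta$; (ii) for all $x\in\mathbb{R}^n$ with $\mathrm{d}(x,M)\le\eta$, $\|\pi_{T_{\pi_M(x)}M}-\pi_{\hat T(x)}\|_{\mathrm{op}}\le\sin\theta$; (iii) for all $x\in\mathbb{R}^n$ with $\mathrm{d}(x,M)\le\Lambda$, $\|\pi_M(x)-\hat\pi(x)\|\le\eta$. Assume furthermore $64\eta\le\Delta\le\mathrm{rch}_{\min}/24$, $\max\{\sin\alpha,\sin\theta\}\le1/64$, $\frac{5\Delta^2}{8\mathrm{rch}_{\min}}+\eta+\Delta\sin\theta\le\Lambda$, and $3\Delta/10\le\delta\le7\Delta/10$. Then Manifold Propagation run with inputs $\hat x_0,\hat T,\hat\pi,\Delta,\delta,\alpha$ terminates (whatever the choices made in it), the number $N_{\mathrm{loop}}$ of iterations of its while loop satisfies $N_{\mathrm{loop}}\le\mathcal{H}^d(M)/(\omega_d(\delta/32)^d)$, and its output $(\mathcal{O},\mathbb{T}_{\mathcal{O}})$ satisfies: $\max_{x\in\mathcal{O}}\mathrm{d}(x,M)\le\eta$; $\max_{p\in M}\mathrm{d}(p,\mathcal{O})\le\Delta+\eta$; and $\mathbb{T}_{\mathcal O}=\{\hat T(x)\}_{x\in\mathcal O}$ with $\max_{x\in\mathcal{O}}\|\pi_{T_{\pi_M(x)}M}-\pi_{\hat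 T(x)}\|_{\mathrm{op}}\le\sin\theta$.
   Context: Notation: $\mathcal{H}^d$ is the $d$-dimensional Hausdorff measure, $\omega_d$ the volume of the unit ball of $\mathbb{R}^d$, $\mathrm{d}(z,K)=\inf_{p\in K}\|p-z\|$. The reach $\mathrm{rch}_K$ of a closed $K$ is the infimum of $\mathrm{d}(z,K)$ over the medial axis (points with at least two distinct nearest points in $K$); $\pi_M$ is the nearest point projection onto $M$; $T_pM$ is the tangent space; $\pi_T$ the orthogonal projection onto a linear subspace $T$; $\|\cdot\|_{\mathrm{op}}$ operator norm. $\mathcal{M}^{n,d}_{\rho}$ is the set of compact connected $d$-dimensional $C^2$ submanifolds of $\mathbb{R}^n$ without boundary with reach $\ge\rho$. Manifold Propagation: inputs are a seed point $\hat x_0\in\mathbb{R}^n$, a map $\hat T$ from $\mathbb{R}^n$ to $d$-dimensional linear subspaces of $\mathbb{R}^n$, a map $\hat\pi:\mathbb{R}^n\to\mathbb{R}^n$, scales $\Delta,\delta>0$ and an angle $0<\alpha<\pi/2$. Initialize $\mathcal Q=\{\hat x_0\}$, $\mathcal O=\emptyset$, $\mathbb T_{\mathcal O}=\emptyset$. While $\mathcal Q\neq\emptyset$: pick (arbitrarily) $x\in\mathcal Q$; set $T=\hat T(x)$ and add $T$ to $\mathbb T_{\mathcal O}$; choose a maximal $(\sin\alpha)$-packing $v_1,\dots,v_k$ of the unit sphere of $T$ (a maximal set of unit vectors of $T$ with pairwise distances $>2\sin\alpha$); for $i=1,\dots,k$ in turn, if $\mathrm{d}(x+\Delta v_i,\mathcal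 Q\cup\mathcal O)\ge\delta$ (with the current sets) then add $\hat\pi(x+\Delta v_i)$ to $\mathcal Q$; then remove $x$ from $\mathcal Q$ and add it to $\mathcal O$. When $\mathcal Q=\emptyset$, return $\mathcal O$ and $\mathbb T_{\mathcal O}$. *)

(* Defs.v *)
(* Points of R^n are row vectors 'rV[R]_n
   with the EUCLIDEAN norm [enorm] defined below (the library norm on
   matrices is the max norm; topology (open/compact/continuity) does not
   depend on this choice). *)
From HB Require Import structures.
From mathcomp Require Import all_boot all_order all_algebra.
From mathcomp Require Import all_classical all_reals all_analysis.
Set Implicit Arguments. Unset Strict Implicit. Unset Printing Implicit Defensive.
Import Order.TTheory GRing.Theory Num.Theory numFieldNormedType.Exports.
Local Open Scope classical_set_scope.
Local Open Scope ring_scope.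

Section MP.
Context {R : realType}.

Definition dotv {n} (u v : 'rV[R]_n) : R := \sum_(i < n) u ord0 i * v ord0 i.
Definition enorm {n} (v : 'rV[R]_n) : R := Num.sqrt (dotv v v).
Definition eudist {n} (x y : 'rV[R]_n) : R := enorm (x - y).

Definition dist_set {n} (z : 'rV[R]_n) (K : set 'rV[R]_n) : R :=
  inf [set eudist p z | p in K].

Definition nearest {n} (K : set 'rV[R]_n) (z : 'rV[R]_n) : set 'rV[R]_n :=
  [set p | K p /\ forall q, K q -> eudist p z <= eudist q z].
Definition medial_axis {n} (K : set 'rV[R]_n) : set 'rV[R]_n :=
  [set z | exists p q, [/\ nearest K z p, nearest K z q & p <> q]].
Definition rch {n} (K : set 'rV[R]_n) : \bar R :=
  ereal_inf [set (dist_set z K)%:E | z in medial_axis K].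
(* pi_K(z): the nearest point (unique where it is used, i.e. within the reach) *)
Definition nproj {n} (K : set 'rV[R]_n) (z : 'rV[R]_n) : 'rV[R]_n :=
  xget 0 (nearest K z).

Definition tangent_space {n} (M : set 'rV[R]_n) (p : 'rV[R]_n) : set 'rV[R]_n :=
  [set v | exists (gam : R -> 'rV[R]_n) (e : R),
     [/\ 0 < e, (forall t, `|t| < e -> M (gam t)), gam 0 = p & is_derive (0 : R) (1 : R) gam v]].

Definition oproj {n} (T : set 'rV[R]_n) (v : 'rV[R]_n) : 'rV[R]_n :=
  xget 0 [set w | T w /\ forall u, T u -> dotv (v - w) u = 0].
Definition opnorm {n} (f : 'rV[R]_n -> 'rV[R]_n) : R :=
  sup [set enorm (f v) | v in [set v | enorm v <= 1]].
Definition vsset {n} (U : {vspace 'rV[R]_n}) : set 'rV[R]_n := [set v | v \in U].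

Definition C2_on {d n} (V : set 'rV[R]_d) (f : 'rV[R]_d -> 'rV[R]_n) : Prop :=
  [/\ {within V, continuous f},
      (forall u, (forall y, V y -> derivable f y u) /\ {within V, continuous ('D_u f)}) &
      (forall u w, (forall y, V y -> derivable ('D_u f) y w) /\
                   {within V, continuous ('D_w ('D_u f))})].

(* d-dimensional C^2 embedded submanifold of R^n without boundary:
   locally the image of a C^2 immersion of an open set of R^d which is a
   homeomorphism onto an open piece of M *)
Definition C2_submanifold {n} (d : nat) (M : set 'rV[R]_n) : Prop :=
  forall p, M p -> exists (U : set 'rV[R]_n) (V : set 'rV[R]_d)
                          (phi : 'rV[R]_d -> 'rV[R]_n),
    [/\ open U /\ U p, open V /\ C2_on V phi,
        (forall y1 y2, V y1 -> V y2 -> phi y1 = phi y2 -> y1 = y2) /\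
        phi @` V = M `&` U,
        (forall y, V y -> forall e, 0 < e -> (exists2 r, 0 < r &
           forall y', V y' -> eudist (phi y') (phi y) < r -> eudist y' y < e)) &
        (forall y u, V y -> 'D_u phi y = 0 -> u = 0)].

Definition manifold_class {n} (d : nat) (rho : R) (M : set 'rV[R]_n) : Prop :=
  [/\ M !=set0, compact M, connected M, C2_submanifold d M & (rho%:E <= rch M)%E].

Fixpoint unit_ball_vol (d : nat) : R :=
  match d with
  | 0 => 1
  | 1 => 2
  | (k.+2)%N => 2 * pi / (k.+2)%:R * unit_ball_vol k
  end.

Definition diam {n} (C : set 'rV[R]_n) : \bar R :=
  ereal_sup ([set (eudist x y)%:E | x in C & y in C] `|` [set 0%E]).
Definition hcontent {n} (d : nat) (C : set 'rV[R]_n) : \bar R :=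
  if pselect (C = set0) then 0%E
  else (unit_ball_vol d * (fine (diam C) / 2) ^+ d)%:E.
Definition hausdorff_approx {n} (d : nat) (del : R) (A : set 'rV[R]_n) : \bar R :=
  ereal_inf [set (\sum_(0 <= i <oo) hcontent d (C i))%E |
     C in [set C : nat -> set 'rV[R]_n |
             A `<=` \bigcup_i C i /\ forall i, (diam (C i) < del%:E)%E]].
Definition hausdorff {n} (d : nat) (A : set 'rV[R]_n) : \bar R :=
  ereal_sup [set hausdorff_approx d del A | del in [set del : R | 0 < del]].

Record mp_state n := MPState {
  mpQ : seq 'rV[R]_n;
  mpO : seq 'rV[R]_n;
  mpT : seq {vspace 'rV[R]_n};
  mpN : nat }.

Definition mp_init {n} (x0 : 'rV[R]_n) : mp_state n := MPState [:: x0] [::] [::] 0.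

Definition unit_sphere {n} (T : {vspace 'rV[R]_n}) : set 'rV[R]_n :=
  [set v | v \in T /\ enorm v = 1].

Definition max_packing {n} (T : {vspace 'rV[R]_n}) (r : R) (vs : seq 'rV[R]_n) : Prop :=
  [/\ uniq vs,
      (forall v, v \in vs -> unit_sphere T v),
      (forall v w, v \in vs -> w \in vs -> v != w -> 2 * r < eudist v w) &
      (forall u, unit_sphere T u -> exists2 v, v \in vs & eudist u v <= 2 * r)].

Definition mp_inner {n} (pihat : 'rV[R]_n -> 'rV[R]_n) (Delta delta : R)
    (x : 'rV[R]_n) (O : seq 'rV[R]_n) (Q : seq 'rV[R]_n) (vs : seq 'rV[R]_n) :=
  foldl (fun Q v =>
           if delta <= dist_set (x + Delta *: v) [set y | y \in Q ++ O]
           then pihat (x + Delta *: v) :: Q else Q) Q vs.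

Inductive mp_step {n} (That : 'rV[R]_n -> {vspace 'rV[R]_n})
    (pihat : 'rV[R]_n -> 'rV[R]_n) (Delta delta alpha : R) :
    mp_state n -> mp_state n -> Prop :=
| MPStep Q O TO N x vs :
    x \in Q -> max_packing (That x) (sin alpha) vs ->
    mp_step That pihat Delta delta alpha (MPState Q O TO N)
      (MPState [seq y <- mp_inner pihat Delta delta x O Q vs | y != x]
               (x :: O) (That x :: TO) N.+1).

Inductive mp_reach {n} (That : 'rV[R]_n -> {vspace 'rV[R]_n})
    (pihat : 'rV[R]_n -> 'rV[R]_n) (Delta delta alpha : R) (s : mp_state n) :
    mp_state n -> Prop :=
| MPRefl : mp_reach That pihat Delta delta alpha s s
| MPTrans s1 s2 : mp_reach That pihat Delta delta alpha s s1 ->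
    mp_step That pihat Delta delta alpha s1 s2 ->
    mp_reach That pihat Delta delta alpha s s2.

End MP.

(* Main.v *)
Require Import Defs.
From HB Require Import structures.
From mathcomp Require Import all_boot all_order all_algebra.
From mathcomp Require Import all_classical all_reals all_analysis.
From mathcomp Require Import ring lra.
Import Order.TTheory GRing.Theory Num.Theory numFieldNormedType.Exports.
Local Open Scope classical_set_scope.
Local Open Scope ring_scope.

Set Implicit Arguments.
Unset Strict Implicit.
Unset Printing Implicit Defensive.

(** Geometry.  Moving a point off [M], within the reach, away from its nearest
    point increases its distance to [M] at unit rate; maximizing
    [dist_set w M - c * eudist w z] turns this into Federer's statement that the
    balls of radius [rho] tangent to [M] contain no point of [M], hence every
    [m] in [M] is within [|m - p|^2 / (2 rho)] of the tangent plane at [p].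
    Conversely [M] projects onto a definite ball of each tangent plane: at a
    point of [M] minimizing the distance between its projection and a target
    [w], the residue would be tangent at [p] and normal at a nearby
    point [q], and following it from [p] would enter an empty ball at [q].

    Measure.  The claimed bound leaves a factor [2 ^ d], so the isodiametric
    inequality is not needed: a set of diameter [D] projects into a ball of
    radius [D] of the tangent plane, and balls covering a ball of radius [r] of
    a [d]-dimensional space satisfy [r ^ d <= sum r_i ^ d].

    Algorithm.  All points found are [3 delta / 4]-separated and [eta]-close to
    [M], which gives termination and the bound on the number of iterations.  The
    points of [M] at distance less than [Delta] from the projected output form a
    closed and open subset of [M]. *)

Ltac vec := apply/rowP => ?; rewrite !mxE; ring.

(** * Euclidean norm against the max norm, distance to a set, nearest points *)

Section Euclid.
Context {R : realType} {n : nat}.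
Implicit Types (u v w x y z p q : 'rV[R]_n) (a b r : R).

Lemma dotvC u v : dotv u v = dotv v u.
Proof. by apply: eq_bigr => i _; rewrite mulrC. Qed.

Lemma dotvDl u v w : dotv (u + v) w = dotv u w + dotv v w.
Proof. by rewrite -big_split; apply: eq_bigr => i _; rewrite mxE mulrDl. Qed.

Lemma dotvZl a u w : dotv (a *: u) w = a * dotv u w.
Proof. by rewrite mulr_sumr; apply: eq_bigr => i _; rewrite mxE mulrA. Qed.

Lemma dotvNl u w : dotv (- u) w = - dotv u w.
Proof. by rewrite -scaleN1r dotvZl mulN1r. Qed.

Lemma dotvBl u v w : dotv (u - v) w = dotv u w - dotv v w.
Proof. by rewrite dotvDl dotvNl. Qed.

Lemma dotvDr u v w : dotv w (u + v) = dotv w u + dotv w v.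
Proof. by rewrite !(dotvC w) dotvDl. Qed.

Lemma dotvZr a u w : dotv w (a *: u) = a * dotv w u.
Proof. by rewrite !(dotvC w) dotvZl. Qed.

Lemma dotvNr u w : dotv w (- u) = - dotv w u.
Proof. by rewrite !(dotvC w) dotvNl. Qed.

Lemma dotvBr u v w : dotv w (u - v) = dotv w u - dotv w v.
Proof. by rewrite !(dotvC w) dotvBl. Qed.

Lemma dotv0l w : dotv 0 w = 0.
Proof. by rewrite -(scale0r w) dotvZl mul0r. Qed.

Lemma dotv0r w : dotv w 0 = 0.
Proof. by rewrite dotvC dotv0l. Qed.

Definition dotvE := (dotvDl, dotvDr, dotvBl, dotvBr, dotvNl, dotvNr, dotvZl, dotvZr).

Lemma dotvv_ge0 u : 0 <= dotv u u.
Proof. by apply: sumr_ge0 => i _; rewrite -expr2 sqr_ge0. Qed.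

Lemma dotvv_eq0 u : dotv u u = 0 -> u = 0.
Proof.
move=> /eqP; rewrite psumr_eq0 => [/allP u0|i _]; last by rewrite -expr2 sqr_ge0.
apply/rowP => i; rewrite mxE; apply/eqP.
by have := u0 i (mem_index_enum _); rewrite mulf_eq0 orbb.
Qed.

Lemma enorm_ge0 u : 0 <= enorm u.
Proof. exact: sqrtr_ge0. Qed.

Lemma enorm_sqr u : enorm u ^+ 2 = dotv u u.
Proof. by rewrite sqr_sqrtr// dotvv_ge0. Qed.

Lemma enorm0 : enorm (0 : 'rV[R]_n) = 0.
Proof. by rewrite /enorm dotv0l sqrtr0. Qed.

Lemma enorm_eq0 u : enorm u = 0 -> u = 0.
Proof. by move=> u0; apply: dotvv_eq0; rewrite -enorm_sqr u0 expr0n. Qed.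

Lemma enorm_gt0 u : u != 0 -> 0 < enorm u.
Proof.
by move=> u0; rewrite lt_def enorm_ge0 andbT; apply: contra u0 => /eqP/enorm_eq0 ->.
Qed.

Lemma enormZ a u : enorm (a *: u) = `|a| * enorm u.
Proof.
by rewrite /enorm dotvZl dotvZr mulrA -expr2 sqrtrM ?sqr_ge0// sqrtr_sqr.
Qed.

Lemma enormN u : enorm (- u) = enorm u.
Proof. by rewrite -scaleN1r enormZ normrN1 mul1r. Qed.

Lemma enorm_sqrD u v : enorm (u + v) ^+ 2 = enorm u ^+ 2 + 2 * dotv u v + enorm v ^+ 2.
Proof. by rewrite !enorm_sqr dotvDl !dotvDr (dotvC v u); ring. Qed.

Lemma enorm_sqrB u v : enorm (u - v) ^+ 2 = enorm u ^+ 2 - 2 * dotv u v + enorm v ^+ 2.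
Proof. by rewrite enorm_sqrD enormN dotvNr; ring. Qed.

Lemma enorm_sqrDZ a u v :
  enorm (u + a *: v) ^+ 2 = enorm u ^+ 2 + 2 * a * dotv u v + a ^+ 2 * enorm v ^+ 2.
Proof. by rewrite enorm_sqrD dotvZr enormZ exprMn real_normK ?num_real//; ring. Qed.

Lemma enorm_leP u r : 0 <= r -> (enorm u <= r) = (dotv u u <= r ^+ 2).
Proof. by move=> r0; rewrite -enorm_sqr ler_sqr ?nnegrE ?enorm_ge0. Qed.

(** Cauchy-Schwarz: the component of [u] orthogonal to [v], scaled by [dotv v v] to avoid a
    division, has nonnegative square norm. *)
Lemma ler_dotv u v : dotv u v <= enorm u * enorm v.
Proof.
have [->|v0] := eqVneq v 0; first by rewrite dotv0r enorm0 mulr0.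
have v_gt0 := enorm_gt0 v0.
have := dotvv_ge0 (dotv v v *: u - dotv u v *: v).
rewrite !dotvE (dotvC v u) -!enorm_sqr => h.
apply: (le_trans (ler_norm _)); rewrite -ler_sqr ?nnegrE ?mulr_ge0 ?enorm_ge0//.
rewrite real_normK ?num_real// exprMn -subr_ge0 -(pmulr_rge0 _ (exprn_gt0 2 v_gt0)).
by apply: le_trans h _; rewrite le_eqVlt; apply/orP; left; apply/eqP; ring.
Qed.

Lemma ler_norm_dotv u v : `|dotv u v| <= enorm u * enorm v.
Proof. by rewrite ler_norml -enormN lerNl -dotvNl !ler_dotv// enormN ler_dotv. Qed.

Lemma ler_enormD u v : enorm (u + v) <= enorm u + enorm v.
Proof.
rewrite enorm_leP ?addr_ge0 ?enorm_ge0// !dotvE sqrrD !enorm_sqr (dotvC v u).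
by have := ler_dotv u v; lra.
Qed.

Lemma ler_enormB u v : enorm (u - v) <= enorm u + enorm v.
Proof. by rewrite (le_trans (ler_enormD _ _))// enormN. Qed.

Lemma enorm_distrC u v : enorm (u - v) = enorm (v - u).
Proof. by rewrite -enormN opprB. Qed.

Lemma ler_enorm_trans u v w : enorm (u - w) <= enorm (u - v) + enorm (v - w).
Proof. by rewrite -[u - w](subrKA v) ler_enormD. Qed.

Lemma ler_enormB_dist u v : enorm u - enorm v <= enorm (u - v).
Proof. by rewrite lerBlDr -{1}(subrK v u) ler_enormD. Qed.

Lemma eudistC x y : eudist x y = eudist y x.
Proof. exact: enorm_distrC. Qed.

Lemma eudist_ge0 x y : 0 <= eudist x y.
Proof. exact: enorm_ge0. Qed.

Lemma eudistxx x : eudist x x = 0.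
Proof. by rewrite /eudist subrr enorm0. Qed.

Lemma eudist_trans y x z : eudist x z <= eudist x y + eudist y z.
Proof. exact: ler_enorm_trans. Qed.

Lemma enorm_unit u : u != 0 -> enorm ((enorm u)^-1 *: u) = 1.
Proof.
move=> /enorm_gt0 u0; rewrite enormZ ger0_norm ?invr_ge0 ?ltW//.
by rewrite mulVf// gt_eqF.
Qed.

(* The topology of ['rV[R]_n] comes from the max norm [`|v|]. *)
Lemma ler_coord_norm u i : `|u ord0 i| <= `|u|.
Proof.
by rewrite [leRHS]/Num.Def.normr/= mx_normrE; apply: le_trans (le_bigmax _ _ (ord0, i)).
Qed.

Lemma ler_coord_enorm u i : `|u ord0 i| <= enorm u.
Proof.
rewrite -ler_sqr ?nnegrE ?enorm_ge0// enorm_sqr real_normK ?num_real//.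
by rewrite /dotv (bigD1 i)//= expr2 lerDl sumr_ge0// => j _; rewrite -expr2 sqr_ge0.
Qed.

Lemma ler_norm_enorm u : `|u| <= enorm u.
Proof.
rewrite [leLHS]/Num.Def.normr/= mx_normrE; apply: bigmax_le; first exact: enorm_ge0.
by move=> [j i] _ /=; rewrite (ord1 j) ler_coord_enorm.
Qed.

Lemma ler_enorm_norm u : enorm u <= n%:R * `|u|.
Proof.
rewrite enorm_leP ?mulr_ge0//.
have -> : (n%:R * `|u|) ^+ 2 = n%:R * (n%:R * `|u| ^+ 2) by ring.
apply: (@le_trans _ _ (\sum_(i < n) `|u| ^+ 2)).
  apply: ler_sum => i _; rewrite -expr2 -(@real_normK _ (u ord0 i)) ?num_real//.
  by rewrite ler_sqr ?nnegrE// ler_coord_norm.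
rewrite sumr_const card_ord -[leLHS]mulr_natl mulrA ler_wpM2r ?sqr_ge0//.
by rewrite -natrM ler_nat; case: (n) => // m; rewrite leq_pmull.
Qed.

Lemma enorm_lip_continuous (f : 'rV[R]_n -> R) C :
  (forall x y, f x - f y <= C * eudist x y) -> continuous f.
Proof.
move=> fC x; apply/(@cvgrPdist_le _ _ _ (nbhs x)) => e e0.
(* The two [+ 1] keep the divisor positive when [C] or [n] is zero. *)
have C1 : 0 < (`|C| + 1) * (n%:R + 1) by rewrite mulr_gt0 ?ltr_wpDl.
have r0 : 0 < e / ((`|C| + 1) * (n%:R + 1)) by rewrite divr_gt0.
apply: filterS (nbhsx_ballx x _ r0) => y.
rewrite -ball_normE /ball_ /= ltr_pdivlMr// => /ltW xy.
have xyn : eudist x y <= `|x - y| * (n%:R + 1).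
  by rewrite (le_trans (ler_enorm_norm _))// mulrC ler_wpM2l// lerDl.
have CE : C * eudist x y <= e.
  rewrite (le_trans _ xy)//.
  have := ler_wpM2l (addr_ge0 (normr_ge0 C) (@ler01 R)) xyn.
  have := ler_wpM2r (eudist_ge0 x y) (ler_norm C); have := eudist_ge0 x y.
  by rewrite mulrDl mul1r; lra.
by rewrite ler_norml; have := fC x y; have := fC y x; rewrite (eudistC y x); lra.
Qed.

Lemma continuous_eudist z : continuous (fun x => eudist x z).
Proof.
apply: (@enorm_lip_continuous _ 1) => x y.
by have := eudist_trans y x z; lra.
Qed.

Definition ecball x r : set 'rV[R]_n := [set y | eudist y x <= r].
Definition eball x r : set 'rV[R]_n := [set y | eudist y x < r].

Lemma ecball_closed x r : closed (ecball x r).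
Proof.
rewrite (_ : ecball x r = (fun y => eudist y x) @^-1` [set t | t <= r])//.
by apply: closed_comp (@closed_le R r) => y _; exact: continuous_eudist.
Qed.

Lemma eball_open x r : open (eball x r).
Proof.
rewrite (_ : eball x r = (fun y => eudist y x) @^-1` [set t | t < r])//.
by apply: open_comp (@open_lt R r) => y _; exact: continuous_eudist.
Qed.

Lemma ecball_compact x r : compact (ecball x r).
Proof.
apply: bounded_closed_compact; last exact: ecball_closed.
exists (`|x| + `|r|); split; first exact: num_real.
move=> M xM y; rewrite /ecball /= => yx; apply: ltW; apply: le_lt_trans xM.
rewrite -{1}(subrK x y) (le_trans (ler_normD _ _))// addrC lerD2l.
by rewrite (le_trans (ler_norm_enorm _))// (le_trans yx)// ler_norm.
Qed.

Lemma compactI_ecball (K : set 'rV[R]_n) x r : compact K -> compact (K `&` ecball x r).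
Proof. by move=> cK; apply: compact_closedI => //; exact: ecball_closed. Qed.

Lemma open_eball (U : set 'rV[R]_n) x : open U -> U x ->
  exists2 r, 0 < r & eball x r `<=` U.
Proof.
move=> oU Ux; have /nbhs_ballP[e /= e0 eU] := open_nbhs_nbhs (conj oU Ux).
exists e => // y yx; apply: eU; rewrite -ball_normE /ball_ /= distrC.
exact: le_lt_trans (ler_norm_enorm _) yx.
Qed.

Lemma compact_argmin (K : set 'rV[R]_n) (f : 'rV[R]_n -> R) :
  K !=set0 -> compact K -> continuous f ->
  exists2 c, K c & forall x, K x -> f c <= f x.
Proof.
move=> K0 cK cf.
have [c cK' h] := EVT_min_rV K0 cK (continuous_subspaceT cf).
by exists c => [|x Kx]; [exact: set_mem|apply: h; exact: mem_set].
Qed.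

Lemma compact_argmax (K : set 'rV[R]_n) (f : 'rV[R]_n -> R) :
  K !=set0 -> compact K -> continuous f ->
  exists2 c, K c & forall x, K x -> f x <= f c.
Proof.
move=> K0 cK cf.
have [c cK' h] := EVT_max_rV K0 cK (continuous_subspaceT cf).
by exists c => [|x Kx]; [exact: set_mem|apply: h; exact: mem_set].
Qed.

Section DistSet.
Variable K : set 'rV[R]_n.
Hypothesis K0 : K !=set0.

Lemma dist_set_le z p : K p -> dist_set z K <= eudist p z.
Proof.
move=> Kp; apply: ge_inf; last by exists p.
by exists 0 => _ [q _ <-]; exact: eudist_ge0.
Qed.

Lemma dist_set_ge z a : (forall p, K p -> a <= eudist p z) -> a <= dist_set z K.
Proof.
move=> aK; apply: lb_le_inf; last by move=> _ [p Kp <-]; exact: aK.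
by case: K0 => p Kp; exists (eudist p z), p.
Qed.

Lemma dist_set_lip x y : dist_set x K - dist_set y K <= eudist x y.
Proof.
rewrite lerBlDr -lerBlDl; apply: dist_set_ge => p Kp; rewrite lerBlDl.
apply: le_trans (dist_set_le x Kp) _.
by rewrite addrC (eudistC x y); exact: eudist_trans.
Qed.

Lemma continuous_dist_set : continuous (fun z => dist_set z K).
Proof. by apply: (@enorm_lip_continuous _ 1) => x y; rewrite mul1r dist_set_lip. Qed.

Lemma dist_set_nearest z p : nearest K z p -> dist_set z K = eudist p z.
Proof.
by move=> [Kp h]; apply/eqP; rewrite eq_le dist_set_le//= dist_set_ge.
Qed.

Lemma nearest_dist_set z p : K p -> eudist p z <= dist_set z K -> nearest K z p.
Proof. by move=> Kp h; split=> // q Kq; exact: le_trans h (dist_set_le _ Kq). Qed.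

Hypothesis cK : compact K.

Lemma nearest_exists z : exists p, nearest K z p.
Proof.
have [p Kp h] := compact_argmin K0 cK (@continuous_eudist z).
by exists p.
Qed.

Lemma nproj_nearest z : nearest K z (nproj K z).
Proof. exact: (xgetPex 0 (nearest_exists z)). Qed.

Lemma nproj_in z : K (nproj K z).
Proof. by case: (nproj_nearest z). Qed.

Lemma eudist_nproj z : eudist (nproj K z) z = dist_set z K.
Proof. by rewrite (dist_set_nearest (nproj_nearest z)). Qed.

(** Two distinct nearest points would put [z] on the medial axis, which stays at distance at least
    [rho] from [K]. *)
Lemma nearest_unique (rho : R) z p q : (rho%:E <= rch K)%E ->
  dist_set z K < rho -> nearest K z p -> nearest K z q -> p = q.
Proof.
move=> rK zr Np Nq; apply/eqP/negPn/negP => /eqP pq.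
have : (rho%:E <= (dist_set z K)%:E)%E.
  by apply: le_trans rK _; apply: ereal_inf_lbound; exists z => //; exists p, q.
by rewrite lee_fin leNgt zr.
Qed.

End DistSet.
End Euclid.

(** * Orthogonal projection onto a linear subspace *)

Section OrthogonalProjection.
Context {R : realType} {n : nat}.
Implicit Types (u v w x : 'rV[R]_n) (W : {vspace 'rV[R]_n}).

(** Gram-Schmidt: the residue [x - px] of a new generator is either zero, and the span does not
    grow, or a direction orthogonal to the old span along which the projection is corrected. *)
Lemma span_orthogonal_decomposition (X : seq 'rV[R]_n) v :
  exists2 w, w \in <<X>>%VS & forall u, u \in <<X>>%VS -> dotv (v - w) u = 0.
Proof.
elim: X v => [|x X IH] v.
  exists 0; first exact: mem0v.
  by move=> u; rewrite span_nil memv0 => /eqP ->; rewrite dotv0r.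
have [px pxX ox] := IH x; have [pv pvX ov] := IH v.
have [x'0|x'0] := eqVneq (x - px) 0.
  have xX : x \in <<X>>%VS by rewrite (subr0_eq x'0).
  have -> : <<x :: X>>%VS = <<X>>%VS.
    by rewrite span_cons; apply/addv_idPr; rewrite -memvE.
  by exists pv.
have x'_gt0 : dotv (x - px) (x - px) != 0.
  by apply: contra x'0 => /eqP/dotvv_eq0 ->.
set c := dotv (v - pv) x / dotv (x - px) (x - px).
have x'x : dotv (x - px) x = dotv (x - px) (x - px) by rewrite dotvBr (ox _ pxX) subr0.
exists (pv + c *: (x - px)).
  rewrite span_cons addrC scalerBr -addrA; apply: memv_add.
    by apply: memvZ; exact: memv_line.
  by rewrite addrC memvB// memvZ.
move=> u; rewrite span_cons => /memv_addP[_ /vlineP[a ->] [u' u'X ->]].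
rewrite opprD addrA dotvDr dotvZr !(dotvBl (v - pv)) !dotvZl (ov _ u'X) (ox _ u'X) x'x.
by rewrite /c divfK//; ring.
Qed.

Lemma oprojP W v :
  oproj (vsset W) v \in W /\ forall u, u \in W -> dotv (v - oproj (vsset W) v) u = 0.
Proof.
have [w wW ow] := span_orthogonal_decomposition (vbasis W) v.
rewrite (span_basis (vbasisP W)) in wW ow.
by apply: (@xgetI _ 0 [set w | vsset W w /\ forall u, vsset W u -> dotv (v - w) u = 0] w).
Qed.

Lemma mem_oproj W v : oproj (vsset W) v \in W.
Proof. by case: (oprojP W v). Qed.

Lemma dotv_oprojB W v u : u \in W -> dotv (v - oproj (vsset W) v) u = 0.
Proof. by case: (oprojP W v) => _; apply. Qed.

Lemma dotv_oproj W v u : u \in W -> dotv (oproj (vsset W) v) u = dotv v u.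
Proof. by move=> uW; apply/esym/eqP; rewrite -subr_eq0 -dotvBl dotv_oprojB. Qed.

Lemma oproj_unique W v w : w \in W -> (forall u, u \in W -> dotv (v - w) u = 0) ->
  oproj (vsset W) v = w.
Proof.
move=> wW ow; apply/eqP; rewrite -subr_eq0; apply/eqP/dotvv_eq0.
have dW : oproj (vsset W) v - w \in W by rewrite memvB// mem_oproj.
rewrite {1}(_ : oproj _ v - w = (v - w) - (v - oproj (vsset W) v)); last first.
  by vec.
by rewrite dotvBl ow// dotv_oprojB// subrr.
Qed.

Lemma oproj_id W w : w \in W -> oproj (vsset W) w = w.
Proof. by move=> wW; apply: oproj_unique => // u _; rewrite subrr dotv0l. Qed.

Lemma oprojD W u v : oproj (vsset W) (u + v) = oproj (vsset W) u + oproj (vsset W) v.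
Proof.
apply: oproj_unique => [|w wW]; first by rewrite memvD ?mem_oproj.
by rewrite opprD addrACA dotvDl !dotv_oprojB// addr0.
Qed.

Lemma oprojZ W a u : oproj (vsset W) (a *: u) = a *: oproj (vsset W) u.
Proof.
apply: oproj_unique => [|w wW]; first by rewrite memvZ ?mem_oproj.
by rewrite -scalerBr dotvZl dotv_oprojB// mulr0.
Qed.

Lemma oprojB W u v : oproj (vsset W) (u - v) = oproj (vsset W) u - oproj (vsset W) v.
Proof. by rewrite oprojD -scaleN1r oprojZ scaleN1r. Qed.

Lemma oproj_pythagoras W v :
  enorm v ^+ 2 = enorm (oproj (vsset W) v) ^+ 2 + enorm (v - oproj (vsset W) v) ^+ 2.
Proof.
have := dotv_oprojB v (mem_oproj W v).
set w := oproj _ _; rewrite !enorm_sqr !dotvE (dotvC w v) => /eqP.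
by rewrite subr_eq0 => /eqP ->; ring.
Qed.

Lemma enorm_oproj W v : enorm (oproj (vsset W) v) <= enorm v.
Proof.
by rewrite -ler_sqr ?nnegrE ?enorm_ge0// (oproj_pythagoras W v) lerDl sqr_ge0.
Qed.

Lemma enorm_oproj_min W v w : w \in W -> enorm (v - oproj (vsset W) v) <= enorm (v - w).
Proof.
move=> wW; rewrite -ler_sqr ?nnegrE ?enorm_ge0// (oproj_pythagoras W (v - w)).
by rewrite !oprojB (oproj_id wW) opprB addrA subrK lerDr sqr_ge0.
Qed.

End OrthogonalProjection.

(** * Federer's inequality at nearest points within the reach *)

Section Federer.
Context {R : realType} {n : nat}.
Implicit Types (u v w x z p q m : 'rV[R]_n).
Variables (K : set 'rV[R]_n) (rho : R).
Hypotheses (K0 : K !=set0) (cK : compact K) (rK : (rho%:E <= rch K)%E).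

Lemma nearest_enorm z p : nearest K z p -> enorm (z - p) = dist_set z K.
Proof. by move=> Np; rewrite enorm_distrC (dist_set_nearest K0 Np). Qed.

(** By uniqueness of [q], the compact set of points of [K] at distance at least [e] from [q] is
    strictly farther from [w] than [q] is. Moving [w] by less than half of that gap cannot bring the
    nearest point there. *)
Lemma nearest_stable w q e : nearest K w q -> dist_set w K < rho -> 0 < e ->
  exists2 h0, 0 < h0 & forall w' q', nearest K w' q' -> eudist w' w < h0 ->
    eudist q' q < e.
Proof.
move=> Nq wr e0; have [[q1 [Kq1 q1e]]|F0] := pselect (exists q', K q' /\ e <= eudist q' q); last first.
  exists 1 => // w' q' [Kq' _] _; rewrite ltNge; apply/negP => h.
  by apply: F0; exists q'.
have cF : compact (K `&` [set q' | e <= eudist q' q]).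
  apply: compact_closedI => //.
  rewrite (_ : mkset _ = (fun y => eudist y q) @^-1` [set t | e <= t])//.
  by apply: closed_comp (@closed_ge R e) => y _; exact: continuous_eudist.
have F1 : (K `&` [set q' | e <= eudist q' q]) !=set0 by exists q1.
have [c [Kc ce] cmin] := compact_argmin F1 cF (@continuous_eudist _ _ w).
have dc : dist_set w K < eudist c w.
  rewrite lt_neqAle dist_set_le// andbT; apply/eqP => E.
  have Nc : nearest K w c by apply: nearest_dist_set; rewrite // E.
  by move: ce; rewrite /= (nearest_unique rK wr Nc Nq) eudistxx leNgt e0.
exists ((eudist c w - dist_set w K) / 2); first by rewrite divr_gt0// subr_gt0.
move=> w' q' Nq' w'w; rewrite ltNge; apply/negP => qe.
have := cmin q' (conj (proj1 Nq') qe).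
have := eudist_trans w' q' w; rewrite -(dist_set_nearest K0 Nq').
by have := dist_set_lip K0 w' w; rewrite (eudistC w' w) in w'w *; lra.
Qed.

(** For small [h] the new nearest point [q'] is within [(1 - c) * D] of [q], so
    [dotv (w - q') (w - q)] is at least [c * D ^+ 2]. Expanding the square of the new distance then
    shows growth at rate [c]. *)
Lemma dist_set_ascent w q c : nearest K w q -> 0 < dist_set w K < rho -> 0 <= c < 1 ->
  exists2 h0, 0 < h0 & forall h, 0 < h < h0 ->
    dist_set w K + c * h <= dist_set (w + (h / dist_set w K) *: (w - q)) K.
Proof.
move=> Nq /andP[w0 wr] /andP[c0 c1]; set D := dist_set w K in w0 wr *.
have e0 : 0 < (1 - c) * D by rewrite mulr_gt0// subr_gt0.
have [h0 h00 Hh] := nearest_stable Nq wr e0.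
exists h0 => // h /andP[hp hh]; set w' := w + _.
have Dq : enorm (w - q) = D by rewrite nearest_enorm.
have w'w : eudist w' w < h0.
  rewrite /eudist /w' addrAC subrr add0r enormZ Dq ger0_norm ?divr_ge0 ?ltW//.
  by rewrite divfK// gt_eqF.
have [q' Nq'] := nearest_exists K0 cK w'.
have {}Hh := ltW (Hh _ _ Nq' w'w).
rewrite (dist_set_nearest K0 Nq') eudistC.
have [Kq' _] := Nq'.
have A := dist_set_le w Kq'; rewrite eudistC -/D in A.
have Dh : 0 <= D + c * h by rewrite addr_ge0 ?mulr_ge0// ltW.
rewrite -ler_sqr ?nnegrE ?eudist_ge0//.
have -> : eudist w' q' ^+ 2 =
    eudist w q' ^+ 2 + 2 * (h / D) * dotv (w - q') (w - q) + h ^+ 2.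
  rewrite /eudist (_ : w' - q' = (w - q') + (h / D) *: (w - q)); last by rewrite /w'; vec.
  by rewrite enorm_sqrDZ Dq; field; rewrite gt_eqF.
have B : c * D ^+ 2 <= dotv (w - q') (w - q).
  rewrite (_ : w - q' = (w - q) - (q' - q)); last by rewrite opprB subrKA.
  rewrite dotvBl -enorm_sqr Dq.
  have := le_trans (ler_dotv (q' - q) (w - q)) (ler_wpM2r (enorm_ge0 _) Hh).
  by rewrite Dq; nra.
have {B} : 2 * h * (c * D) <= 2 * (h / D) * dotv (w - q') (w - q).
  rewrite (_ : 2 * h * (c * D) = 2 * (h / D) * (c * D ^+ 2)); last by field; rewrite gt_eqF.
  by rewrite ler_wpM2l// !mulr_ge0// ?invr_ge0 ltW.
have A2 : D ^+ 2 <= eudist w q' ^+ 2 by rewrite ler_sqr ?nnegrE ?eudist_ge0// ltW.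
have : (c * h) ^+ 2 <= h ^+ 2.
  by rewrite ler_sqr ?nnegrE ?mulr_ge0 ?ler_piMl// ltW.
nra.
Qed.

(** The distance to [K] reaches [t + s] at its maximum [w] on the closed ball of radius [s] around
    [z]. Otherwise a penalty of slope [c] slightly below 1 gives a maximizer [w1] interior to the
    ball, and ascending from [w1] at the faster rate [(1 + c) / 2] contradicts maximality. *)
Lemma nearest_extend z p s : nearest K z p -> 0 < dist_set z K -> 0 < s ->
  dist_set z K + s < rho ->
  nearest K (z + (s / dist_set z K) *: (z - p)) p.
Proof.
move=> Np t0 s0 tsr; set t := dist_set z K in t0 tsr *.
have B0 : ecball z s !=set0 by exists z; rewrite /ecball /= eudistxx ltW.
have cB := @ecball_compact _ _ z s.
have [w Bw wmax] := compact_argmax B0 cB (continuous_dist_set K0).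
have ts : t + s <= dist_set w K.
  rewrite leNgt; apply/negP => wts.
  have [c [c0 c1 wc]] : exists c, [/\ 0 <= c, c < 1 & dist_set w K < t + c * s].
    have tw : t <= dist_set w K by apply: wmax; rewrite /ecball /= eudistxx ltW.
    (* Halfway between 1 and the mean slope [(dist_set w K - t) / s], which is below 1. *)
    exists ((1 + (dist_set w K - t) / s) / 2).
    have a1 : (dist_set w K - t) / s < 1 by rewrite ltr_pdivrMr// mul1r; lra.
    have a0 : 0 <= (dist_set w K - t) / s by rewrite divr_ge0 ?subr_ge0// ltW.
    split; [lra|lra|].
    rewrite -ltrBlDl -ltr_pdivrMr//; lra.
  have cg : continuous (fun x => dist_set x K - c * eudist x z).
    apply: (@enorm_lip_continuous _ _ _ 2) => x y.
    have := dist_set_lip K0 x y; have := eudist_trans x y z; rewrite (eudistC y x).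
    have := eudist_ge0 x y; nra.
  have [w1 Bw1 w1max] := compact_argmax B0 cB cg.
  have tw1 : t <= dist_set w1 K - c * eudist w1 z.
    by have := w1max z; rewrite eudistxx mulr0 subr0; apply; rewrite /ecball /= eudistxx ltW.
  (* On the sphere [w1] would be at distance at least [t + c * s] from [K], above the maximum at
     [w]. *)
  have [w1s|w1s] := ltP (eudist w1 z) s; last first.
    have := wmax _ Bw1; have := ler_wpM2l c0 w1s; lra.
  have w1r : 0 < dist_set w1 K < rho.
    have := dist_set_lip K0 w1 z; have := mulr_ge0 c0 (eudist_ge0 w1 z); rewrite -/t.
    by move=> ? ?; apply/andP; split; lra.
  have [q1 Nq1] := nearest_exists K0 cK w1.
  have c'1 : 0 <= (1 + c) / 2 < 1 by apply/andP; split; lra.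
  have [h0 h00 Hh] := dist_set_ascent Nq1 w1r c'1.
  pose h := Num.min (h0 / 2) (s - eudist w1 z).
  have hp : 0 < h by rewrite lt_min divr_gt0//= subr_gt0.
  have hh0 : h < h0 by rewrite gt_min; apply/orP; left; lra.
  have hs : h <= s - eudist w1 z by rewrite ge_min lexx orbT.
  have := Hh h; rewrite hp hh0 => /(_ isT); set w2 := w1 + _ => up.
  have w21 : eudist w2 w1 = h.
    rewrite /eudist /w2 addrAC subrr add0r enormZ (nearest_enorm Nq1).
    by case/andP: w1r => d0 _; rewrite ger0_norm ?divr_ge0 ?ltW// divfK// gt_eqF.
  have w2z := eudist_trans w1 w2 z.
  have := w1max w2; rewrite /ecball /= => /(_ _).
  have -> : eudist w2 z <= s by lra.
  move=> /(_ isT).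
  have := ler_wpM2l c0 w2z; rewrite w21; nra.
have [Kp _] := Np.
have Dp : enorm (z - p) = t by rewrite nearest_enorm.
have wz : enorm (w - z) <= s := Bw.
have wp : t + s <= enorm (w - p).
  by apply: le_trans ts (le_trans (dist_set_le _ Kp) _); rewrite eudistC.
(* Equality case of the triangle inequality for [p], [z] and [w]. *)
have wE : w = z + (s / t) *: (z - p).
  apply/eqP; rewrite -subr_eq0; apply/eqP/dotvv_eq0/eqP.
  rewrite eq_le dotvv_ge0 andbT opprD addrA -enorm_sqr enorm_sqrB dotvZr enormZ Dp.
  rewrite exprMn real_normK ?num_real//.
  have wp2 : (t + s) ^+ 2 <= enorm (w - p) ^+ 2.
    by rewrite ler_sqr ?nnegrE ?enorm_ge0 ?addr_ge0// ltW.
  have wz2 : enorm (w - z) ^+ 2 <= s ^+ 2 by rewrite ler_sqr ?nnegrE ?enorm_ge0// ltW.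
  rewrite (_ : w - p = (w - z) + (z - p)) in wp2; last by rewrite subrKA.
  rewrite enorm_sqrD Dp sqrrD in wp2.
  have ip : s * t <= dotv (w - z) (z - p) by lra.
  have : (s / t) * (s * t) <= (s / t) * dotv (w - z) (z - p).
    by rewrite ler_wpM2l// divr_ge0// ltW.
  have -> : s / t * (s * t) = s ^+ 2 by field; rewrite gt_eqF.
  have -> : (s / t) ^+ 2 * t ^+ 2 = s ^+ 2 by field; rewrite gt_eqF.
  lra.
rewrite -wE; apply: nearest_dist_set => //; apply: le_trans ts.
have := eudist_trans z w p; rewrite /eudist Dp (enorm_distrC p w).
by rewrite addrC -/(eudist w p); lra.
Qed.

(* Federer: the balls of radius [rho] tangent to [K] at [q] on the side of [z]
   do not meet [K]. *)
Lemma nearest_reach_ineq z q m : nearest K z q -> dist_set z K < rho -> K m ->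
  2 * rho * dotv (z - q) (m - q) <= dist_set z K * enorm (m - q) ^+ 2.
Proof.
move=> Nq zr Km; set t := dist_set z K in zr *.
have t0 : 0 <= t by apply: dist_set_ge => // p _; exact: eudist_ge0.
have zq : enorm (z - q) = t by rewrite nearest_enorm.
have [t00|tn0] := eqVneq t 0.
  have -> : z - q = 0 by apply: enorm_eq0; rewrite zq.
  by rewrite dotv0l t00 mulr0 mul0r.
have tp : 0 < t by rewrite lt_def tn0.
have H r : t < r < rho -> 2 * r * dotv (z - q) (m - q) <= t * enorm (m - q) ^+ 2.
  move=> /andP[tr rr].
  have rt : 0 < r - t by rewrite subr_gt0.
  have [] := nearest_extend Nq tp rt; first by rewrite -/t; lra.
  move=> _ /(_ m Km); rewrite -/t.
  have -> : z + ((r - t) / t) *: (z - q) = q + (r / t) *: (z - q).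
    rewrite (_ : (r - t) / t = r / t - 1); last by rewrite mulrBl divff.
    by vec.
  rewrite (eudistC m) (eudistC q) /eudist.
  rewrite (_ : q + _ - m = (q - m) + (r / t) *: (z - q)); last by vec.
  rewrite (_ : q + _ - q = (r / t) *: (z - q)); last by vec.
  move=> h0; have : enorm ((r / t) *: (z - q)) ^+ 2 <= enorm (q - m + (r / t) *: (z - q)) ^+ 2.
    by rewrite ler_sqr ?nnegrE ?enorm_ge0.
  rewrite enorm_sqrDZ enormZ exprMn real_normK ?num_real// zq.
  rewrite -(opprB m q) dotvNl enormN dotvC.
  move=> h; have {}h : 2 * (r / t * dotv (z - q) (m - q)) <= enorm (m - q) ^+ 2 by lra.
  have := ler_wpM2l t0 h.
  by rewrite (_ : t * (2 * _) = 2 * r * dotv (z - q) (m - q)); last by field.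
have [d0|d0] := leP (dotv (z - q) (m - q)) 0.
  apply: (@le_trans _ _ 0); last by rewrite mulr_ge0 ?sqr_ge0.
  by rewrite mulr_ge0_le0// mulr_ge0//; lra.
rewrite leNgt; apply/negP => lt.
set d := dotv _ _ in H d0 lt; set E := t * _ in H lt.
have E2 : E / (2 * d) < rho by rewrite ltr_pdivrMr ?mulr_gt0//; lra.
(* The inequality [H] holds for radii below [rho] only. If it failed at [rho], it would already fail
   at this [r], chosen above [E / (2 * d)]. *)
pose r := (Num.max t (E / (2 * d)) + rho) / 2.
have mr : Num.max t (E / (2 * d)) < rho by rewrite gt_max zr.
have r1 : t < r < rho.
  have : t <= Num.max t (E / (2 * d)) by rewrite le_max lexx.
  rewrite /r => ?; apply/andP; split; lra.
have := H r r1; apply/negP; rewrite -ltNge.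
have : E / (2 * d) < r.
  have : E / (2 * d) <= Num.max t (E / (2 * d)) by rewrite le_max lexx orbT.
  rewrite /r; lra.
by rewrite ltr_pdivrMr ?mulr_gt0//; lra.
Qed.

End Federer.

(** * From continuous partial derivatives to a first-order expansion *)

Section DirectionalDerivatives.
Context {R : realType}.

Lemma is_derive_first_order {n} (gam : R -> 'rV[R]_n) v : is_derive (0 : R) (1 : R) gam v ->
  forall e, 0 < e -> exists2 s, 0 < s &
    forall t, `|t| < s -> enorm (gam t - gam 0 - t *: v) <= e * `|t|.
Proof.
move=> [dg gv] e e0.
have n0 : 0 < n%:R + 1 :> R by rewrite ltr_wpDl.
have : (fun h => h^-1 *: (gam (h *: 1 + 0) - gam 0)) @ 0^' --> v by rewrite -gv; exact: dg.
move=> /cvgrPdist_le /(_ (e / (n%:R + 1))); rewrite divr_gt0// => /(_ isT) /= [s /= s0 H].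
exists s => // t ts.
have [->|t0] := eqVneq t 0; first by rewrite subrr scale0r subrr enorm0 normr0 mulr0.
have := H t; rewrite /ball_ /= sub0r normrN => /(_ ts t0).
rewrite [t *: 1]mulr1 addr0 => K.
rewrite (_ : _ - _ - _ = (- t) *: (v - t^-1 *: (gam t - gam 0))); last first.
  by rewrite scalerBr scalerA mulNr mulfV// scaleN1r opprK scaleNr addrC.
rewrite enormZ normrN mulrC ler_wpM2r//.
apply: le_trans (ler_enorm_norm _) _.
apply: le_trans (ler_wpM2l (ler0n _ _) K) _.
by rewrite mulrA ler_pdivrMr// mulrC ler_wpM2l ?(ltW e0)// lerDl.
Qed.

Lemma derivable_line {d} {E : normedModType R} (f : 'rV[R]_d -> E) y u (t : R) :
  derivable f (t *: u + y) u -> is_derive t 1 (fun s : R => f (s *: u + y)) ('D_u f (t *: u + y)).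
Proof.
have fE : (fun h : R => h^-1 *: (((fun s => f (s *: u + y)) (h *: 1 + t)) - f (t *: u + y))) =
         (fun h : R => h^-1 *: (f (h *: u + (t *: u + y)) - f (t *: u + y))).
  by apply/funext => h; rewrite [h *: 1]mulr1 scalerDl addrA.
by move=> df; split; [rewrite /derivable fE|rewrite /derive fE].
Qed.

Lemma directional_mean_value {d} (f : 'rV[R]_d -> R) y u (a c e : R) :
  (forall t : R, `|t| <= `|a| -> derivable f (t *: u + y) u) ->
  (forall t : R, `|t| <= `|a| -> `|'D_u f (t *: u + y) - c| <= e) ->
  `|f (a *: u + y) - f y - a * c| <= e * `|a|.
Proof.
move=> df bf; pose g (s : R) := f (s *: u + y).
have dg (t : R) : `|t| <= `|a| -> is_derive t 1 g ('D_u f (t *: u + y)).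
  by move=> ta; apply: derivable_line; exact: df.
have [t ta E] : exists2 t, `|t| <= `|a| & f (a *: u + y) - f y = 'D_u f (t *: u + y) * a.
  have gE : f y = g 0 by rewrite /g scale0r add0r.
  rewrite gE -/(g a); have [a0|a0] := leP 0 a.
    have ina (t : R) : t \in `[0, a]%R -> `|t| <= `|a|.
      by rewrite in_itv /= => /andP[t0 ta]; rewrite !ger0_norm.
    have [||c' /ina c'a E] := @MVT_segment R g (fun t => 'D_u f (t *: u + y)) 0 a a0.
      by move=> x x0a; apply: dg; apply: ina; exact: subset_itv_oo_cc.
      apply: derivable_within_continuous => x /ina /dg dx.
      exact: ex_derive.
    by exists c' => //; rewrite E subr0.
  have ina (t : R) : t \in `[a, 0]%R -> `|t| <= `|a|.
    by rewrite in_itv /= => /andP[t0 ta]; rewrite !ler0_norm ?lerN2// ltW.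
  have [||c' /ina c'a E] := @MVT_segment R g (fun t => 'D_u f (t *: u + y)) a 0 (ltW a0).
    by move=> x x0a; apply: dg; apply: ina; exact: subset_itv_oo_cc.
    apply: derivable_within_continuous => x /ina /dg dx.
    exact: ex_derive.
  by exists c' => //; rewrite -opprB E sub0r mulrN opprK.
rewrite E (mulrC a) -mulrBl normrM ler_wpM2r//; exact: bf.
Qed.

(** Vertices of the path from 0 to [h] along the coordinate axes: consecutive ones differ in a
    single coordinate. *)
Definition row_prefix {d} (h : 'rV[R]_d) (k : nat) : 'rV[R]_d :=
  \row_j (if (j < k)%N then h ord0 j else 0).

Lemma row_prefixS {d} (h : 'rV[R]_d) (k : 'I_d) :
  row_prefix h k.+1 = h ord0 k *: delta_mx ord0 k + row_prefix h k.
Proof.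
apply/rowP => j; rewrite !mxE eqxx /= ltnS leq_eqVlt.
have [->|] := eqVneq j k; first by rewrite eqxx ltnn mulr1 addr0.
by rewrite -val_eqE /= => /negPf -> /=; rewrite mulr0 add0r.
Qed.

Lemma norm_row_prefix {d} (h : 'rV[R]_d) k (i : 'I_d) t : `|t| <= `|h ord0 i| ->
  `|t *: delta_mx ord0 i + row_prefix h k| <= `|h| + `|h|.
Proof.
move=> ti; apply: le_trans (ler_normD _ _) (lerD _ _).
  rewrite [leLHS]/Num.Def.normr/= mx_normrE; apply: bigmax_le => //= -[j l] _ /=.
  rewrite !mxE normrM (ord1 j) eqxx /=; apply: le_trans (le_trans ti (ler_coord_norm _ _)).
  by case: eqP; rewrite ?normr1 ?mulr1// normr0 mulr0.
rewrite [leLHS]/Num.Def.normr/= mx_normrE; apply: bigmax_le => //= -[j l] _ /=.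
by rewrite mxE; case: ifP => _; rewrite ?normr0// ler_coord_norm.
Qed.

(** The increment of [f] telescopes along the prefixes of [h]. Each piece is parallel to an axis,
    where the mean value theorem and the continuity of one partial derivative suffice. *)
Lemma continuous_partials_scalar {d} (V : set 'rV[R]_d) (f : 'rV[R]_d -> R) y :
  open V -> V y ->
  (forall u z, V z -> derivable f z u) ->
  (forall u, {for y, continuous ('D_u f)}) ->
  forall e, 0 < e -> exists2 s, 0 < s & forall h, `|h| < s ->
    `|f (h + y) - f y - \sum_(i < d) h ord0 i * 'D_(delta_mx ord0 i) f y| <= e * `|h|.
Proof.
move=> oV Vy df cf e e0.
have e'0 : 0 < e / (d%:R + 1) by rewrite divr_gt0// ltr_wpDl.
have : \forall z \near y, V z /\ forall i : 'I_d,
    `|'D_(delta_mx ord0 i) f y - 'D_(delta_mx ord0 i) f z| <= e / (d%:R + 1).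
  near=> z; split; first by near: z; exact: open_nbhs_nbhs.
  near: z; apply: filter_forall => i.
  by have /(@cvgrPdist_le _ _ _ (nbhs y)) := cf (delta_mx ord0 i); exact.
(* The radius is halved because a point on the path has norm at most [|h| + |h|]. *)
move=> /nbhs_ballP[s /= s0 H]; exists (s / 2); first by rewrite divr_gt0.
move=> h hs.
have fE : f (h + y) - f y =
    \sum_(i < d) (f (row_prefix h i.+1 + y) - f (row_prefix h i + y)).
  rewrite -(big_mkord xpredT (fun i => f (row_prefix h i.+1 + y) - f (row_prefix h i + y))).
  rewrite telescope_sumr//; congr (f (_ + _) - f _).
    by apply/rowP => j; rewrite !mxE ltn_ord.
  by apply/rowP => j; rewrite !mxE /= add0r.
rewrite fE -sumrB; apply: le_trans (ler_norm_sum _ _ _) _.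
apply: (@le_trans _ _ (\sum_(i < d) e / (d%:R + 1) * `|h|)); last first.
  rewrite sumr_const card_ord -[leLHS]mulr_natl mulrA ler_wpM2r// mulrCA ler_piMr ?ltW//.
  by rewrite ltr_pdivrMr ?mul1r ?ltrDl// ltr_wpDl.
apply: ler_sum => i _; rewrite row_prefixS -(addrA (_ *: _)).
have near_t t : `|t| <= `|h ord0 i| ->
    ball y s (t *: delta_mx ord0 i + (row_prefix h i + y)).
  move=> ti; rewrite -ball_normE /ball_ /= addrA opprD addrCA subrr addr0 normrN.
  by apply: le_lt_trans (norm_row_prefix _ ti) _; rewrite (splitr s) ltrD.
apply: le_trans (directional_mean_value (e := e / (d%:R + 1)) _ _) _.
- by move=> t ti; apply: df; case: (H _ (near_t _ ti)).
- by move=> t ti; rewrite distrC; case: (H _ (near_t _ ti)) => _; apply.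
by rewrite ler_wpM2l ?(ltW e'0)// ler_coord_norm.
Unshelve. all: by end_near. Qed.


Lemma continuous_partials_differential {d n} (V : set 'rV[R]_d) (phi : 'rV[R]_d -> 'rV[R]_n) y :
  open V -> V y -> C2_on V phi ->
  forall e, 0 < e -> exists2 s, 0 < s & forall h, enorm h < s ->
    enorm (phi (h + y) - phi y
      - h *m \matrix_(i < d) 'D_(delta_mx ord0 i) phi y) <= e * enorm h.
Proof.
move=> oV Vy [_ C1 _] e e0.
have e'0 : 0 < e / (n%:R + 1) by rewrite divr_gt0// ltr_wpDl.
have comp (j : 'I_n) : \forall s \near 0^'+, forall h, `|h| < s ->
    `|(phi (h + y) - phi y - h *m \matrix_(i < d) 'D_(delta_mx ord0 i) phi y) ord0 j|
      <= e / (n%:R + 1) * `|h|.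
  have derj u z : V z -> 'D_u (fun x => phi x ord0 j) z = ('D_u phi z) ord0 j.
    by move=> Vz; rewrite derive_mx ?mxE//; case: (C1 u) => + _; apply.
  have [u z Vz|u|s s0 H] :=
      @continuous_partials_scalar _ V (fun x => phi x ord0 j) y oV Vy _ _ _ e'0.
  - by case: (C1 u) => /(_ z Vz) /derivable_mxP.
  - have [_ cD] := C1 u.
    have {}cD : {for y, continuous ('D_u phi)}.
      by move: cD; rewrite continuous_open_subspace// => /(_ y); apply; exact: mem_set.
    have cj : {for y, continuous (fun z => ('D_u phi z) ord0 j)}.
      apply: (@continuous_comp _ _ _ ('D_u phi) (fun M : 'rV[R]_n => M ord0 j)) => //.
      exact: coord_continuous.
    rewrite /prop_for /continuous_at derj//; apply: cvg_trans cj.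
    apply: (@near_eq_cvg _ _ (nbhs y)); near=> z; rewrite derj//.
    by near: z; exact: open_nbhs_nbhs.
  - near=> s' => h hs'; have hs : `|h| < s.
      by apply: lt_le_trans hs' _; near: s'; exact: nbhs_right_le.
    have := H h hs; rewrite !mxE => /(le_trans _); apply; rewrite le_eqVlt; apply/orP; left.
    apply/eqP; congr `|_ - _|; apply: eq_bigr => i _; rewrite mxE derj//.
have : \forall s \near 0^'+, 0 < s /\ forall j : 'I_n, forall h, `|h| < s ->
    `|(phi (h + y) - phi y - h *m \matrix_(i < d) 'D_(delta_mx ord0 i) phi y) ord0 j|
      <= e / (n%:R + 1) * `|h|.
  near=> s; split; first by near: s; exact: nbhs_right_gt.
  by near: s; apply: filter_forall => j; exact: comp.
move=> /(@filter_ex _ _ _) [s [s0 H]]; exists s => // h hs.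
have {}hs := le_lt_trans (ler_norm_enorm h) hs.
apply: le_trans (ler_enorm_norm _) _.
apply: (@le_trans _ _ (n%:R * (e / (n%:R + 1) * `|h|))).
  rewrite ler_wpM2l// [leLHS]/Num.Def.normr/= mx_normrE; apply: bigmax_le.
    by rewrite mulr_ge0// ltW.
  by move=> [i j] _ /=; rewrite (ord1 i) H.
rewrite mulrA ler_pM ?mulr_ge0 ?(ltW e'0) ?(ltW e0)// ?ler_norm_enorm//.
by rewrite mulrA ler_pdivrMr ?ltr_wpDl// mulrC ler_wpM2l ?(ltW e0)// lerDl.
Unshelve. all: by end_near. Qed.

End DirectionalDerivatives.

(** * Tangent spaces of submanifolds as first-order approximations *)

Section TangentSpace.
Context {R : realType}.

(* All that is used of a chart: to first order, [M] is [p + W] near [p]. *)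
Definition approximates {n} (M : set 'rV[R]_n) (p : 'rV[R]_n) (W : {vspace 'rV[R]_n}) : Prop :=
  (forall e, 0 < e -> exists2 s, 0 < s & forall v, v \in W -> enorm v <= s ->
     exists2 m, M m & enorm (m - p - v) <= e * enorm v) /\
  (forall e, 0 < e -> exists2 s, 0 < s & forall m, M m -> enorm (m - p) <= s ->
     exists2 v, v \in W & enorm (m - p - v) <= e * enorm (m - p)).

Lemma enorm_mulmx_bounded {m n} (A : 'M[R]_(m, n)) :
  exists2 C, 0 < C & forall h : 'rV[R]_m, enorm (h *m A) <= C * enorm h.
Proof.
exists (n%:R * (\sum_(i < m) `|row i A|) + 1); first by rewrite ltr_wpDl// mulr_ge0// sumr_ge0.
move=> h; apply: le_trans (ler_enorm_norm _) _; rewrite mulmx_sum_row.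
rewrite mulrDl mul1r ler_wpDr ?enorm_ge0// -mulrA ler_wpM2l// mulr_suml.
apply: le_trans (ler_norm_sum _ _ _) _; apply: ler_sum => i _.
by rewrite normrZ mulrC ler_wpM2l// ler_coord_enorm.
Qed.

(** [W] is the image of the differential [J] of a chart at the parameter [y] of [p]. Points near
    [p + W] are images of [h + y]. Conversely the chart being a homeomorphism makes the parameter of
    a nearby [m] close to [y], and injectivity of [J] makes it comparable to [m - p]. Lines through
    [y] yield curves with velocity [h *m J]. *)
Lemma C2_submanifold_approximates {n d} (M : set 'rV[R]_n) p : C2_submanifold d M -> M p ->
  exists W : {vspace 'rV[R]_n},
    [/\ \dim W = d, approximates M p W & forall v, v \in W -> tangent_space M p v].
Proof.
move=> CM Mp; have [U [V [phi [[oU Up] [oV C2V] [_ imV] hom imm]]]] := CM p Mp.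
have [y Vy yp] : (phi @` V) p by rewrite imV.
have phiM z : V z -> M (phi z) by move=> Vz; have : (phi @` V) (phi z); [exists z|rewrite imV => -[]].
have [r0 r00 rV] := open_eball oV Vy.
have [r1 r10 rU] := open_eball oU Up.
pose J := \matrix_(i < d) 'D_(delta_mx ord0 i) phi y.
have diffJ := continuous_partials_differential oV Vy C2V; rewrite -/J yp in diffJ.
have curve h : is_derive (0 : R) (1 : R) (fun t : R => phi (t *: h + y)) (h *m J).
  have : (fun t : R => t^-1 *: (phi ((t *: 1 + 0) *: h + y) - phi (0 *: h + y))) @ 0^' --> h *m J.
    apply/cvgrPdist_le => e e0.
    have e'0 : 0 < e / (enorm h + 1) by rewrite divr_gt0// ltr_wpDl ?enorm_ge0.
    have [s s0 H] := diffJ _ e'0.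
    near=> t.
    have t0 : t != 0 by near: t; exact: nbhs_dnbhs_neq.
    rewrite [t *: 1]mulr1 addr0 scale0r add0r yp.
    rewrite (_ : _ - _ = (- t^-1) *: (phi (t *: h + y) - p - (t *: h) *m J)); last first.
      by rewrite -scalemxAl [RHS]scalerBr scalerA !mulNr mulVf// scaleN1r opprK scaleNr addrC.
    rewrite normrZ normrN normfV ler_pdivrMl ?normr_gt0//.
    apply: le_trans (ler_norm_enorm _) _; apply: le_trans (H _ _) _; last first.
      rewrite enormZ mulrCA ler_wpM2l// -mulrA ler_piMr ?(ltW e0)//.
      by rewrite mulrC ler_pdivrMr ?mul1r ?lerDl// ltr_wpDl ?enorm_ge0.
    rewrite enormZ; apply: (@le_lt_trans _ _ (`|t| * (enorm h + 1))).
      by rewrite ler_wpM2l// lerDl.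
    rewrite -ltr_pdivlMr ?ltr_wpDl ?enorm_ge0//.
    by near: t; apply: dnbhs0_lt; rewrite divr_gt0// ltr_wpDl ?enorm_ge0.
  move=> H; split; first by apply/cvg_ex; exists (h *m J).
  by apply/cvg_lim.
(* The immersion hypothesis concerns ['D_h phi y], which the curve above identifies with
   [h *m J]. *)
have fullJ : row_free J.
  apply: inj_row_free => h hJ0; apply: (imm y h Vy).
  have [_ Cder _] := C2V; have dh : derivable phi (0 *: h + y) h.
    by rewrite scale0r add0r; case: (Cder h) => + _; apply.
  have := @derive_val _ _ _ _ _ _ _ (derivable_line dh).
  by rewrite (@derive_val _ _ _ _ _ _ _ (curve h)) hJ0 scale0r add0r => <-.
have [C C0 HC] := enorm_mulmx_bounded (pinvmx J).
have {}HC h : enorm h <= C * enorm (h *m J) by rewrite -[h in leLHS](mulmxKp fullJ) HC.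
pose L : 'Hom('rV[R]_d, 'rV[R]_n) := linfun (mulmxr J).
have LE h : L h = h *m J by rewrite lfunE.
exists (limg L); split.
- have /eqP L0 : lker L == 0%VS by apply/lker0P => u v; rewrite !LE => /(row_free_inj fullJ).
  rewrite limg_dim_eq ?L0 ?capv0// dimvf dim_matrix. exact: mul1n.
- split=> e e0.
    have [s s0 H] := diffJ (e / C) (divr_gt0 e0 C0).
    pose s' := Num.min (s / 2) (r0 / 2).
    have s'0 : 0 < s' by rewrite lt_min !divr_gt0.
    exists (s' / C); first by rewrite divr_gt0.
    move=> _ /memv_imgP[h _ ->]; rewrite LE ler_pdivlMr// mulrC => hs'.
    have hs := le_trans (HC h) hs'.
    have /andP[hs1 hs2] : (enorm h < s) && (enorm h < r0).
      by move: hs; rewrite le_min => /andP[? ?]; apply/andP; split; lra.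
    exists (phi (h + y)).
      by apply: phiM; apply: rV; rewrite /eball /= /eudist addrK.
    apply: le_trans (H h hs1) _; rewrite mulrAC ler_pdivrMr// -mulrA.
    by rewrite ler_wpM2l ?(ltW e0)// mulrC.
  (* The bound [1 / (2 * C)] absorbs the error of the expansion and gives
     [enorm (z - y) <= 2 * C * enorm (m - p)]; the bound [e / (2 * C)] then gives the claim. *)
  pose e' := Num.min (e / (2 * C)) (1 / (2 * C)).
  have e'0 : 0 < e' by rewrite lt_min !divr_gt0// mulr_gt0.
  have [s s0 H] := diffJ e' e'0.
  have [r r_gt0 Hr] := hom y Vy s s0.
  pose s' := Num.min (r / 2) (r1 / 2).
  exists s'; first by rewrite lt_min !divr_gt0.
  move=> m Mm ms'.
  have /andP[mr mr1] : (enorm (m - p) < r) && (enorm (m - p) < r1).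
    by move: ms'; rewrite le_min => /andP[? ?]; apply/andP; split; lra.
  have [z Vz zm] : (phi @` V) m by rewrite imV; split=> //; apply: rU.
  have zy : enorm (z - y) < s by apply: Hr => //; rewrite yp zm.
  have Hz := H _ zy; rewrite subrK zm in Hz.
  exists (L (z - y)); first by apply/memv_imgP; exists (z - y) => //; exact: memvf.
  rewrite LE; apply: (le_trans Hz).
  have k1 : enorm (z - y) <= C * (enorm (m - p) + e' * enorm (z - y)).
    apply: le_trans (HC _) _; rewrite ler_wpM2l ?(ltW C0)//.
    apply: le_trans (lerD (lexx _) Hz).
    by have := ler_enormB (m - p) (m - p - (z - y) *m J); rewrite subKr.
  have e'1 : e' * (2 * C) <= 1 by rewrite -ler_pdivlMr ?mulr_gt0// ge_min lexx orbT.
  have e'2 : e' * (2 * C) <= e by rewrite -ler_pdivlMr ?mulr_gt0// ge_min lexx.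
  have k2 : enorm (z - y) <= 2 * C * enorm (m - p).
    have := ler_wpM2r (enorm_ge0 (z - y)) e'1; lra.
  apply: le_trans (ler_wpM2l (ltW e'0) k2) _.
  by rewrite mulrA ler_wpM2r ?enorm_ge0.
move=> v /memv_imgP[h _ ->]; rewrite LE.
have h0 : 0 < enorm h + 1 by rewrite ltr_wpDl ?enorm_ge0.
exists (fun t => phi (t *: h + y)), (r0 / (enorm h + 1)); split.
- by rewrite divr_gt0.
- move=> t; rewrite ltr_pdivlMr// => tr; apply: phiM; apply: rV.
  rewrite /eball /= /eudist addrK enormZ; apply: le_lt_trans tr.
  by rewrite ler_wpM2l// lerDl.
- by rewrite scale0r add0r.
- exact: curve.
Unshelve. all: by end_near. Qed.

(** [gam t] is close both to [p + t *: v] and to [p + W]. Dividing by [t] shows that [v] is at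
    arbitrarily small distance from [W]. *)
Lemma tangent_space_approximates {n} (M : set 'rV[R]_n) p W v :
  approximates M p W -> tangent_space M p v -> v \in W.
Proof.
move=> [_ A2] [gam [e1 [e10 gM g0 dg]]].
suff vP : v - oproj (vsset W) v = 0 by rewrite (subr0_eq vP) mem_oproj.
apply: enorm_eq0; apply/eqP; rewrite eq_le enorm_ge0 andbT; apply/ler_addgt0Pl => e e0.
rewrite addr0.
(* The two errors after division by [t] are [e' * (enorm v + 1)] and [e']. *)
pose B := enorm v + 2; have B0 : 0 < B by rewrite ltr_wpDl ?enorm_ge0.
pose e' := Num.min 1 (e / B); have e'0 : 0 < e' by rewrite lt_min ltr01 divr_gt0.
have [e'1 e'B] : e' <= 1 /\ e' * B <= e.
  by split; rewrite -?ler_pdivlMr// ge_min lexx ?orbT.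
have [s s0 Hs] := is_derive_first_order dg e'0.
have [s2 s20 Hs2] := A2 _ e'0.
have B1 : 0 < enorm v + 1 by rewrite ltr_wpDl ?enorm_ge0.
pose t := Num.min (Num.min (s / 2) (e1 / 2)) (s2 / (enorm v + 1)).
have t0 : 0 < t by rewrite !lt_min !divr_gt0.
have tn : `|t| = t by rewrite ger0_norm// ltW.
have [ts [te ts2]] : t < s /\ t < e1 /\ t * (enorm v + 1) <= s2.
  split; [|split].
  - by apply: (@le_lt_trans _ _ (s / 2)); [rewrite !ge_min lexx|lra].
  - by apply: (@le_lt_trans _ _ (e1 / 2)); [rewrite !ge_min lexx orbT|lra].
  - by rewrite -ler_pdivlMr// !ge_min lexx !orbT.
have Ht : enorm (gam t - p - t *: v) <= e' * t by have := Hs t; rewrite g0 tn; exact.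
have gtp : enorm (gam t - p) <= t * (enorm v + 1).
  have := ler_enormD (t *: v) (gam t - p - t *: v).
  by rewrite subrKC enormZ tn; have := ler_wpM2r (ltW t0) e'1; lra.
have [|w wW Hw] := Hs2 (gam t) _ (le_trans gtp ts2); first by apply: gM; rewrite tn.
have key : enorm (v - t^-1 *: w) <= e' * B.
  rewrite (_ : v - _ = t^-1 *: ((gam t - p - w) - (gam t - p - t *: v))); last first.
    rewrite (_ : gam t - p - w - _ = t *: v - w); last by vec.
    by rewrite scalerBr scalerA mulVf ?scale1r// gt_eqF.
  rewrite enormZ ger0_norm ?invr_ge0 ?(ltW t0)// ler_pdivrMl//.
  have := ler_enormB (gam t - p - w) (gam t - p - t *: v).
  have := ler_wpM2l (ltW e'0) gtp; rewrite /B; lra.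
by apply: le_trans (le_trans key e'B); apply: enorm_oproj_min; rewrite memvZ.
Qed.

End TangentSpace.

(** * Sets of positive reach: distance to tangent planes and projection onto them *)

(** Expanding the square, a vector of [W] pairs with [x] as with its projection. This turns
    minimality of a residue into the hypothesis of [first_order_normal]. *)
Lemma oproj_no_closer {R : realType} {n} (W : {vspace 'rV[R]_n}) e x : e \in W ->
  enorm e <= enorm (e - oproj (vsset W) x) -> 2 * dotv e x <= enorm x ^+ 2.
Proof.
move=> eW; rewrite -ler_sqr ?nnegrE ?enorm_ge0// enorm_sqrB.
rewrite (dotvC e (oproj _ x)) (dotv_oproj x eW) (dotvC x e).
have : enorm (oproj (vsset W) x) ^+ 2 <= enorm x ^+ 2.
  by rewrite ler_sqr ?nnegrE ?enorm_ge0// enorm_oproj.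
lra.
Qed.

Section Reach.
Context {R : realType} {n : nat}.
Implicit Types (u v w x z p q m : 'rV[R]_n) (W : {vspace 'rV[R]_n}).
Variables (M : set 'rV[R]_n) (rho : R).
Hypotheses (cM : compact M) (rho0 : 0 < rho) (rM : (rho%:E <= rch M)%E).
Hypothesis HM : forall p, M p -> exists W, approximates M p W.

(** Near [q] the set contains points close to [q + t *: v]. On them the left side is about
    [2 * t * dotv a v] and the right side is quadratic in [t], so [dotv a v] cannot be positive; the
    same holds for [- v]. *)
Lemma first_order_normal q W a r : approximates M q W -> 0 < r ->
  (forall m, M m -> enorm (m - q) <= r -> 2 * dotv a (m - q) <= enorm (m - q) ^+ 2) ->
  forall v, v \in W -> dotv a v = 0.
Proof.
move=> [A1 _] r0 Ha.
suff S v : v \in W -> dotv a v <= 0.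
  move=> v vW; apply/eqP; rewrite eq_le S//=.
  by have := S (- v); rewrite memvN dotvNr oppr_le0; apply.
move=> vW; rewrite leNgt; apply/negP => k0; set k := dotv a v in k0.
have V0 : 0 < enorm v.
  by apply: enorm_gt0; apply/eqP => v0; rewrite /k v0 dotv0r ltxx in k0.
have aV : 0 <= enorm a * enorm v by rewrite mulr_ge0 ?enorm_ge0.
(* [e] keeps the error paired with [a] below [k / 2], and [t] below keeps the quadratic term under
   [k / 2]: together [k < k / 2]. *)
pose e := Num.min 1 (k / (2 * (enorm a * enorm v + 1))).
have B0 : 0 < 2 * (enorm a * enorm v + 1) by rewrite mulr_gt0// ltr_wpDl.
have [e0 e1 ek] : [/\ 0 < e, e <= 1 & e * (2 * (enorm a * enorm v + 1)) <= k].
  split; first by rewrite lt_min ltr01 divr_gt0.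
    by rewrite ge_min lexx.
  by rewrite -ler_pdivlMr// ge_min lexx orbT.
clearbody e.
have [s s0 Hs] := A1 e e0.
pose t := Num.min (Num.min (s / enorm v) (r / (2 * enorm v))) (k / (8 * enorm v ^+ 2)).
have [t0 ts tr tk] : [/\ 0 < t, t * enorm v <= s, t * (2 * enorm v) <= r &
    t * (8 * enorm v ^+ 2) <= k].
  have V2 : 0 < 8 * enorm v ^+ 2 by rewrite mulr_gt0// exprn_gt0.
  have V1 : 0 < 2 * enorm v by rewrite mulr_gt0.
  split; first by rewrite !lt_min !divr_gt0.
  - by rewrite -ler_pdivlMr// !ge_min lexx.
  - by rewrite -ler_pdivlMr// !ge_min lexx orbT.
  - by rewrite -ler_pdivlMr// !ge_min lexx orbT.
clearbody t.
have tv : enorm (t *: v) = t * enorm v by rewrite enormZ gtr0_norm.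
have [||m Mm] := Hs (t *: v); [by rewrite memvZ|by rewrite tv|rewrite tv => mv].
have mq : enorm (m - q) <= 2 * (t * enorm v).
  have := ler_enormD (m - q - t *: v) (t *: v); rewrite subrK tv.
  by have := ler_wpM2r (mulr_ge0 (ltW t0) (ltW V0)) e1; lra.
have := Ha m Mm; rewrite (le_trans mq) => [/(_ isT)|]; last by lra.
have -> : m - q = (m - q - t *: v) + t *: v by rewrite subrK.
rewrite [dotv _ _]dotvDr dotvZr -/k subrK => L.
have mq2 : enorm (m - q) ^+ 2 <= (2 * (t * enorm v)) ^+ 2.
  by rewrite ler_sqr ?nnegrE ?enorm_ge0// mulr_ge0// mulr_ge0// ltW.
have L1 : - (enorm a * (e * (t * enorm v))) <= dotv a (m - q - t *: v).
  have := ler_norm_dotv a (m - q - t *: v); rewrite ler_norml => /andP[+ _].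
  apply: le_trans; rewrite lerN2; apply: ler_wpM2l mv; exact: enorm_ge0.
have : 2 * (t * k - enorm a * (e * (t * enorm v))) <= (2 * (t * enorm v)) ^+ 2 by lra.
have -> : 2 * (t * k - enorm a * (e * (t * enorm v))) =
  t * (2 * (k - e * (enorm a * enorm v))) by ring.
have -> : (2 * (t * enorm v)) ^+ 2 = t * (t * (8 * enorm v ^+ 2) / 2) by field.
rewrite ler_pM2l//; lra.
Qed.

(** A nearest point [q] of [p + t *: nu] is not yet known to be [p], but [enorm (q - p) ^+ 2 <= 2 *
    t * dotv nu (q - p)] and [nu] is normal to first order, whence [enorm (q - p) <= 2 * t * e].
    Federer's inequality at [q], divided by [t], gives the claim up to a multiple of [e]. *)
Lemma normal_reach_ineq p W nu m : M p -> approximates M p W ->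
  (forall v, v \in W -> dotv nu v = 0) -> M m ->
  2 * rho * dotv nu (m - p) <= enorm nu * enorm (m - p) ^+ 2.
Proof.
have rp := rho0.
move=> Mp AW.
have M0 : M !=set0 by exists p.
wlog nu1 : nu / enorm nu = 1.
  move=> S nuW Mm; have [->|nu0] := eqVneq nu 0; first by rewrite dotv0l enorm0 mul0r mulr0.
  have := S ((enorm nu)^-1 *: nu) (enorm_unit nu0) _ Mm.
  rewrite (enorm_unit nu0) mul1r dotvZl => H.
  have {}H : 2 * rho * ((enorm nu)^-1 * dotv nu (m - p)) <= enorm (m - p) ^+ 2.
    by apply: H => v vW; rewrite dotvZl nuW// mulr0.
  by move: H; rewrite mulrCA ler_pdivrMl ?enorm_gt0.
move=> nuW Mm; rewrite nu1 mul1r.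
set B := enorm (m - p); set b := dotv nu (m - p).
have B0 : 0 <= B := enorm_ge0 _.
suff H e : 0 < e -> e < 1 -> 2 * rho * b <= B ^+ 2 + e * (4 * rho + 4 * rho * B + 4 * B + 4).
  apply/ler_addgt0Pl => e e0.
  set C := 4 * rho + 4 * rho * B + 4 * B + 4 in H.
  have C0 : 0 < C.
    have := mulr_ge0 (ltW rho0) B0; rewrite /C; lra.
  pose e' := Num.min (1 / 2) (e / C).
  have e'0 : 0 < e' by rewrite lt_min !divr_gt0.
  have e'1 : e' < 1 by rewrite gt_min ltr_pdivrMr// mul1r ltr1n.
  apply: (le_trans (H _ e'0 e'1)); rewrite addrC lerD2r -ler_pdivlMr//.
  by rewrite ge_min lexx orbT.
move=> e0 e1; have [_ A2] := AW; have [s s0 Hs] := A2 e e0.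
(* [2 * t <= s] keeps [q] where the expansion at [p] is valid, [t < rho] keeps [p + t *: nu] within
   the reach, and [t <= 1] simplifies the errors. *)
pose t := Num.min (Num.min (s / 2) (rho / 2)) 1.
have [t0 ts tr t1] : [/\ 0 < t, 2 * t <= s, t < rho & t <= 1].
  split.
  - by rewrite !lt_min !divr_gt0/=.
  - by rewrite mulrC -ler_pdivlMr// !ge_min lexx.
  - by apply: (@le_lt_trans _ _ (rho / 2)); [rewrite !ge_min lexx orbT|lra].
  - by rewrite ge_min lexx orbT.
clearbody t.
have [q Nq] := nearest_exists M0 cM (p + t *: nu).
have [Mq Nqp] := Nq.
have tnu : enorm (t *: nu) = t by rewrite enormZ nu1 mulr1 gtr0_norm.
have D : enorm (t *: nu - (q - p)) <= t.
  have := Nqp p Mp; rewrite (eudistC p) (eudistC q) /eudist.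
  rewrite (_ : _ - p = t *: nu); last by vec.
  by rewrite tnu (_ : _ - q = t *: nu - (q - p)); last by vec.
have qp2 : enorm (q - p) <= 2 * t.
  by have := ler_enormB (t *: nu) (t *: nu - (q - p)); rewrite subKr tnu; lra.
have [v vW Hv] := Hs q Mq (le_trans qp2 ts).
have nx : dotv nu (q - p) <= e * enorm (q - p).
  have -> : dotv nu (q - p) = dotv nu (q - p - v) by rewrite (dotvBr (q - p)) (nuW v)// subr0.
  by have := ler_dotv nu (q - p - v); rewrite nu1 mul1r => /le_trans; apply.
set X := enorm (q - p) in qp2 nx *.
have X0 : 0 <= X := enorm_ge0 _.
have X2 : X <= 2 * t * e.
  have : enorm (t *: nu - (q - p)) ^+ 2 <= t ^+ 2 by rewrite ler_sqr ?nnegrE ?enorm_ge0// ltW.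
  rewrite enorm_sqrB tnu dotvZl -/X => H.
  have {}H : X * X <= (2 * t * e) * X by have := ler_wpM2l (ltW t0) nx; lra.
  have [->|Xn0] := eqVneq X 0; first by rewrite !mulr_ge0// ltW.
  by rewrite -(ler_pM2r (_ : 0 < X)) // lt_def Xn0.
have dq : dist_set (p + t *: nu) M <= t.
  have := dist_set_le (p + t *: nu) Mp; rewrite eudistC /eudist.
  by rewrite (_ : _ - p = t *: nu) ?tnu//; vec.
have := nearest_reach_ineq M0 cM rM Nq (le_lt_trans dq tr) Mm.
rewrite (_ : p + t *: nu - q = t *: nu - (q - p)); last by vec.
rewrite (_ : m - q = (m - p) - (q - p)); last by vec.
rewrite dotvBl !(dotvBr (m - p)) !dotvZl -/b -enorm_sqr -/X => F.
have E1 : enorm (m - p - (q - p)) ^+ 2 <= (B + X) ^+ 2.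
  by rewrite ler_sqr ?nnegrE ?enorm_ge0 ?addr_ge0//; exact: ler_enormB.
have E2 : dist_set (p + t *: nu) M * enorm (m - p - (q - p)) ^+ 2 <= t * (B + X) ^+ 2.
  by apply: ler_pM => //; [apply: dist_set_ge => // *; exact: eudist_ge0|exact: sqr_ge0].
have E3 := ler_dotv (q - p) (m - p); rewrite -/B -/X in E3.
have E4 : 2 * rho * (t * b - t * (e * X) - X * B) <= t * (B + X) ^+ 2.
  apply: le_trans E2; apply: le_trans F; rewrite ler_wpM2l//; first by lra.
  have := ler_wpM2l (ltW t0) nx; have := sqr_ge0 X; lra.
have Xe : X <= 2 * e by have := ler_wpM2r (ltW e0) t1; lra.
have E5 : (B + X) ^+ 2 <= B ^+ 2 + 4 * e * B + 4 * e.
  have : X ^+ 2 <= 4 * e.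
    have := ler_pM X0 X0 Xe Xe; rewrite -expr2; have := ler_wpM2l (ltW e0) (ltW e1); lra.
  have := ler_wpM2r B0 Xe; rewrite sqrrD; lra.
have E6 : 2 * rho * (t * b - t * (2 * e) - 2 * t * e * B) <= t * (B + X) ^+ 2.
  apply: le_trans E4; rewrite ler_wpM2l//; first by lra.
  have : t * (e * X) <= t * (2 * e).
    by rewrite ler_wpM2l ?(ltW t0)//; have := ler_wpM2r X0 (ltW e1); lra.
  have := ler_wpM2r B0 X2; lra.
have : t * (2 * rho * (b - 2 * e - 2 * e * B)) <= t * (B + X) ^+ 2.
  by apply: le_trans E6; rewrite le_eqVlt; apply/orP; left; apply/eqP; ring.
rewrite ler_pM2l// => E7; lra.
Qed.

(** Take as normal vector the normal part of [m - p] itself, whose product with [m - p] is its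
    square norm, and divide by its norm. *)
Lemma normal_part_le p W m : M p -> approximates M p W -> M m ->
  2 * rho * enorm (m - p - oproj (vsset W) (m - p)) <= enorm (m - p) ^+ 2.
Proof.
have rp := rho0.
move=> Mp AW Mm; set x := m - p; set N := x - oproj (vsset W) x.
have NW v : v \in W -> dotv N v = 0 by exact: dotv_oprojB.
have := normal_reach_ineq Mp AW NW Mm; rewrite -/x.
have -> : dotv N x = enorm N ^+ 2.
  by rewrite enorm_sqr (dotvBr x _ N) (NW _ (mem_oproj W x)) subr0.
have [->|N0] := eqVneq (enorm N) 0; first by rewrite mulr0 sqr_ge0.
by rewrite expr2 mulrCA ler_pM2l// lt_def N0 enorm_ge0.
Qed.

(** First half of [approximates] with the relative error frozen at 1/4, so that only the scale [s]
    remains to be enlarged. *)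
Definition near_plane p W s := forall v, v \in W -> enorm v <= s ->
  exists2 m, M m & enorm (m - p - v) <= enorm v / 4.

(* [M] avoids the ball of radius [rho] tangent at [q] and centered in direction
   [e], whereas moving from [p] by [t] along [e] enters that ball. *)
Lemma tangent_not_normal p q Wp Wq e s : M p -> M q -> approximates M q Wq ->
  near_plane p Wp s -> 0 < s -> enorm (q - p) <= 11 * s -> enorm (q - p) <= rho / 11 ->
  e \in Wp -> enorm e = 1 -> (forall v, v \in Wq -> dotv e v = 0) -> False.
Proof.
have rp := rho0.
move=> Mp Mq AW Hp s0 as_ ar.
(* With this sign, the displacements from [q] to [p] and along [e] add up. *)
wlog ep : e / 0 <= dotv e (p - q).
  move=> S eW e1 eq; have [h|h] := leP 0 (dotv e (p - q)); first exact: (S e).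
  apply: (S (- e)); rewrite ?memvN ?enormN//; first by rewrite dotvNl oppr_ge0 ltW.
  by move=> v vW; rewrite dotvNl eq// oppr0.
move=> eW e1 eq; set a := enorm (q - p) in as_ ar.
have a0 : 0 <= a := enorm_ge0 _.
(* Both [a ^+ 2] and [121 * t ^+ 2] are then at most [rho * t], hence so is [11 * a * t]. This keeps
   [(a + t + t / 4) ^+ 2] below the value [3 / 2 * rho * t] that Federer's inequality requires. *)
pose t := Num.min s (rho / 121).
have [t0 ts tr] : [/\ 0 < t, t <= s & t <= rho / 121].
  by split; rewrite ?lt_min ?s0 ?divr_gt0// ge_min lexx ?orbT.
have at_ : a ^+ 2 <= rho * t.
  have h1 : a ^+ 2 <= a * rho / 11 by have := ler_wpM2l a0 ar; rewrite expr2; lra.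
  rewrite /t minEle; case: ifP => _.
    have := ler_wpM2l (ltW rho0) as_; lra.
  have := ler_wpM2r (ltW rho0) ar; lra.
clearbody t.
have te : enorm (t *: e) = t by rewrite enormZ e1 mulr1 gtr0_norm.
have [||m Mm] := Hp (t *: e); [by rewrite memvZ|by rewrite te|rewrite te => Hm].
have := normal_reach_ineq Mq AW eq Mm; rewrite e1 mul1r => F.
have mE : m - q = (p - q) + t *: e + (m - p - t *: e) by vec.
have mq : enorm (m - q) <= a + t + t / 4.
  rewrite mE; apply: le_trans (ler_enormD _ _) _; apply: lerD => //.
  by apply: le_trans (ler_enormD _ _) _; rewrite te lerD2r enorm_distrC.
have mq2 : enorm (m - q) ^+ 2 <= (a + t + t / 4) ^+ 2.
  by rewrite ler_sqr ?nnegrE ?enorm_ge0//; lra.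
have L1 : - (t / 4) <= dotv e (m - p - t *: e).
  have := ler_norm_dotv e (m - p - t *: e); rewrite ler_norml e1 mul1r => /andP[+ _].
  by apply: le_trans; rewrite lerN2.
have L2 : 3 / 4 * t <= dotv e (m - q).
  rewrite mE [dotv _ _]dotvDr (dotvDr (p - q)) dotvZr -enorm_sqr e1 expr1n; lra.
have L3 : rho * t * (3 / 2) <= (a + t + t / 4) ^+ 2.
  by apply: le_trans mq2; apply: le_trans F; have := ler_wpM2l (ltW rho0) L2; lra.
have T2 : t ^+ 2 <= rho * t / 121 by have := ler_wpM2r (ltW t0) tr; rewrite expr2; lra.
have T0 : 0 < rho * t by rewrite mulr_gt0.
have := sqr_ge0 (a - 11 * t).
have -> : (a - 11 * t) ^+ 2 = a ^+ 2 - 22 * (a * t) + 121 * t ^+ 2 by ring.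
have E : (a + t + t / 4) ^+ 2 = a ^+ 2 + 5 / 2 * (a * t) + 25 / 16 * t ^+ 2 by field.
rewrite E in L3; lra.
Qed.

(** Let [q] minimize the distance from the projection of [q - p] to [w] over [M] in the closed ball
    of radius [r]. The minimizer is interior, so a nonzero residue [e], which lies in [W], would be
    normal at [q], against [tangent_not_normal]. *)
Lemma projection_covers_of_near_plane p W s r w : M p -> approximates M p W ->
  near_plane p W s -> 0 < s -> 0 < r -> r <= 11 * s -> r <= rho / 11 ->
  w \in W -> enorm w <= 49 / 100 * r ->
  exists q, [/\ M q, enorm (q - p) <= r & oproj (vsset W) (q - p) = w].
Proof.
have rp := rho0.
move=> Mp AW Hp s0 r0 rs rr wW wr.
pose P := oproj (vsset W).
have B0 : (M `&` ecball p r) !=set0.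
  by exists p; split=> //; rewrite /ecball /= eudistxx ltW.
have cf : continuous (fun q => enorm (w - P (q - p))).
  apply: (@enorm_lip_continuous _ _ _ 1) => x y; rewrite mul1r.
  apply: le_trans (ler_enormB_dist _ _) _.
  rewrite (_ : _ - _ = P (y - x)) ?(eudistC x) ?enorm_oproj//.
  by rewrite (_ : y - x = (y - p) - (x - p)) ?/P ?(oprojB W (y - p)); vec.
have [q [Mq Bq] qmin] := compact_argmin B0 (compactI_ecball cM) cf.
have {}Bq : enorm (q - p) <= r := Bq.
exists q; split => //; rewrite -/P.
set e := w - P (q - p) in qmin *.
suff : e = 0 by rewrite /e => /eqP; rewrite subr_eq0 => /eqP ->.
apply/eqP/negPn/negP => e_n0.
have eW : e \in W by rewrite memvB// mem_oproj.
have ew : enorm e <= enorm w.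
  have := qmin p; rewrite subrr /P (oproj_id (mem0v W)) subr0; apply.
  by split=> //; rewrite /ecball /= eudistxx ltW.
(* On the sphere the projection has norm at most [2 * enorm w <= 98 / 100 * r] and the normal part
   at most [r / 22]; their squares do not add up to [r ^+ 2]. *)
have qr : enorm (q - p) < r.
  rewrite lt_neqAle Bq andbT; apply/eqP => qr.
  have Pq : enorm (P (q - p)) <= 98 / 100 * r.
    by have := ler_enormB w e; rewrite /e subKr -/e; lra.
  have := oproj_pythagoras W (q - p); rewrite -/P qr => py.
  have NN := normal_part_le Mp AW Mq; rewrite -/P qr in NN.
  have N1 : enorm (q - p - P (q - p)) <= r / 22.
    rewrite -(ler_pM2l (_ : 0 < 2 * rho)) ?mulr_gt0//; apply: le_trans NN _.
    by have := ler_wpM2l (ltW r0) rr; rewrite expr2; lra.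
  have := ler_pM (enorm_ge0 _) (enorm_ge0 _) Pq Pq.
  have := ler_pM (enorm_ge0 _) (enorm_ge0 _) N1 N1.
  rewrite -!expr2 => ? ?; have : 0 < r ^+ 2 by rewrite exprn_gt0.
  lra.
have [Wq AWq] := HM Mq.
have eNq : forall v, v \in Wq -> dotv e v = 0.
  apply: (@first_order_normal q Wq e (r - enorm (q - p)) AWq); first by rewrite subr_gt0.
  move=> m Mm mq.
  apply: (oproj_no_closer eW).
  rewrite (_ : e - _ = w - P (m - p)); last first.
    rewrite /e (_ : m - p = (m - q) + (q - p)); last by vec.
    by rewrite /P (oprojD W (m - q)); vec.
  apply: qmin; split=> //; rewrite /ecball /=.
  by apply: le_trans (eudist_trans q _ _) _; rewrite /eudist; lra.
apply: (@tangent_not_normal p q W Wq ((enorm e)^-1 *: e) s) => //.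
- exact: le_trans Bq rs.
- exact: le_trans Bq rr.
- by rewrite memvZ.
- exact: enorm_unit.
- by move=> v vW; rewrite dotvZl eNq// mulr0.
Qed.

(** The normal part is at most [a / 22], so [a ^+ 2 <= 484 / 483 * enorm w ^+ 2] by Pythagoras, with
    [484 = 22 ^ 2]; [normal_part_le] is thereby expressed through [w]. *)
Lemma graph_height_le p W q w : M p -> approximates M p W -> M q ->
  enorm (q - p) <= rho / 11 -> oproj (vsset W) (q - p) = w ->
  2 * rho * enorm (q - p - w) <= 484 / 483 * enorm w ^+ 2.
Proof.
have rp := rho0.
move=> Mp AW Mq qr Pw; have := normal_part_le Mp AW Mq.
have := oproj_pythagoras W (q - p); rewrite Pw.
set a := enorm (q - p) in qr *; set N := enorm (q - p - w) => py NN.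
have a0 : 0 <= a := enorm_ge0 _.
have Na : N <= a / 22.
  rewrite -(ler_pM2l (_ : 0 < 2 * rho)) ?mulr_gt0//; apply: le_trans NN _.
  by have := ler_wpM2l a0 qr; rewrite expr2; lra.
have := ler_pM (enorm_ge0 _) (enorm_ge0 _) Na Na; rewrite -/N -!expr2 expr_div_n.
lra.
Qed.

(* The initial scale depends on [p]; multiplying it by five as long as it stays
   below a fixed fraction of the reach makes it uniform. *)
Lemma near_plane_grow p W s : M p -> approximates M p W -> near_plane p W s -> 0 < s ->
  near_plane p W (Num.min (5 * s) (rho / 23)).
Proof.
have rp := rho0.
move=> Mp AW Hp s0 w wW; rewrite le_min => /andP[ws wr].
(* [49 / 100 * r] is at least the new scale, since 11 * 49 / 100 exceeds 5 and 49 / 1100 exceeds 1 /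
   23. *)
pose r := Num.min (11 * s) (rho / 11).
have r0 : 0 < r by rewrite lt_min mulr_gt0// divr_gt0.
have rs : r <= 11 * s by rewrite ge_min lexx.
have rr : r <= rho / 11 by rewrite ge_min lexx orbT.
have wr' : enorm w <= 49 / 100 * r by rewrite /r minEle; case: ifP => _; lra.
have [q [Mq qp Pw]] := projection_covers_of_near_plane Mp AW Hp s0 r0 rs rr wW wr'.
exists q => //; have := graph_height_le Mp AW Mq (le_trans qp rr) Pw.
rewrite -(ler_pM2l (_ : 0 < 2 * rho) (enorm _)) ?mulr_gt0// => /le_trans; apply.
have := ler_wpM2r (enorm_ge0 w) wr; rewrite expr2; have := mulr_ge0 (ltW rho0) (enorm_ge0 w); lra.
Qed.

Lemma near_plane_full p W : M p -> approximates M p W -> near_plane p W (rho / 23).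
Proof.
have rp := rho0.
move=> Mp AW; have [A1 _] := AW.
have [|s s0 Hs] := A1 (1 / 4); first by rewrite divr_gt0.
have Hk k : near_plane p W (Num.min (5 ^+ k * s) (rho / 23)).
  elim: k => [|k IH].
    move=> v vW; rewrite expr0 mul1r le_min => /andP[vs _].
    by have [m Mm Hm] := Hs v vW vs; exists m => //; lra.
  have k0 : 0 < Num.min (5 ^+ k * s) (rho / 23).
    by rewrite lt_min divr_gt0// andbT mulr_gt0// exprn_gt0.
  have := near_plane_grow Mp AW IH k0 => H v vW vs; apply: (H v vW).
  move: vs; rewrite !le_min => /andP[v1 v2]; rewrite v2 andbT.
  rewrite minEle; case: ifP => _; last lra.
  by rewrite mulrA -exprS.
have [k Hk2] : exists k, rho / 23 <= 5 ^+ k * s.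
  (* [2 ^+ k] already exceeds [rho / 23 / s]. *)
  pose k := Num.bound (rho / 23 / s); exists k.
  rewrite -ler_pdivrMr//; apply: ltW.
  apply: lt_le_trans (upper_nthrootP (leqnn k)) _.
  by rewrite lerXn2r ?nnegrE ?ler_nat.
by have := Hk k; rewrite (min_idPr Hk2).
Qed.

Lemma projection_covers p W r w : M p -> approximates M p W ->
  0 < r -> r <= rho / 11 -> w \in W -> enorm w <= 49 / 100 * r ->
  exists q, [/\ M q, enorm (q - p) <= r & oproj (vsset W) (q - p) = w].
Proof.
have rp := rho0.
move=> Mp AW r0 rr wW wr.
have s0 : 0 < rho / 23 by rewrite divr_gt0.
by apply: (projection_covers_of_near_plane Mp AW (near_plane_full Mp AW) s0) => //; lra.
Qed.

(** The height bound of the graph over the tangent plane, with 484 / 966 rounded up to 5 / 8. The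
    radius [100 / 49 * enorm w] is the smallest that [projection_covers] accepts, and is below
    [rho / 11] as [enorm w <= rho / 24]. *)
Lemma tangent_dist_le p W w : M p -> approximates M p W -> w \in W -> enorm w <= rho / 24 ->
  exists2 q, M q & enorm (q - p - w) <= 5 * enorm w ^+ 2 / (8 * rho).
Proof.
have rp := rho0.
move=> Mp AW wW wr; have [->|w0] := eqVneq w 0.
  by exists p => //; rewrite subrr subr0 enorm0 expr0n mulr0 mul0r.
have w_gt0 := enorm_gt0 w0.
have [||||q [Mq qp Pw]] := @projection_covers p W (100 / 49 * enorm w) w Mp AW => //.
- by rewrite mulr_gt0.
- lra.
- lra.
exists q => //; rewrite ler_pdivlMr ?mulr_gt0//.
have := graph_height_le Mp AW Mq (_ : enorm (q - p) <= rho / 11) Pw.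
have := sqr_ge0 (enorm w); lra.
Qed.

End Reach.

(** * Covers of a ball of a subspace by balls *)

(** Coordinates of two members of [S] differ by at most [m], so reduction modulo [m.+1] is injective
    on [S]. *)
Lemma card_bounded_spread d N m (S : {set {ffun 'I_d -> 'I_N}}) :
  (forall k k' j, k \in S -> k' \in S -> (k' j <= k j + m)%N) -> (#|S| <= m.+1 ^ d)%N.
Proof.
move=> HS; pose f (k : {ffun 'I_d -> 'I_N}) := [ffun j => (inord (k j %% m.+1) : 'I_m.+1)].
have finj : {in S &, injective f}.
  move=> k k' kS k'S /ffunP fk; apply/ffunP => j; apply: val_inj => /=.
  have := fk j; rewrite !ffunE => /(congr1 val).
  rewrite /= !inordK ?ltn_pmod// => E.
  wlog kk' : k k' kS k'S fk E / (k j <= k' j)%N.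
    by move=> W; case/orP: (leq_total (k j) (k' j)) => h; [exact: W|exact/esym/W].
  have : (k' j == k j %[mod m.+1])%N by rewrite E.
  rewrite eqn_mod_dvd// => /dvdn_leq; rewrite subn_gt0 => H.
  apply/eqP; rewrite eqn_leq kk' leqNgt; apply/negP => /H.
  by have := HS k k' j kS k'S; rewrite -leq_subLR; case: leqP => // /leq_trans h /h; rewrite ltnn.
rewrite -(card_in_imset finj); apply: leq_trans (max_card _) _.
by rewrite card_ffun !card_ord.
Qed.

Section BallCover.
Context {R : realType} {n : nat}.
Implicit Types (W : {vspace 'rV[R]_n}) (l : seq ('rV[R]_n * R)).

Lemma row_free_lower_bound {d} (J : 'M[R]_(d, n)) : row_free J ->
  exists2 C, 0 < C & forall h : 'rV[R]_d, enorm h <= C * enorm (h *m J).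
Proof.
move=> fJ; have [C C0 HC] := enorm_mulmx_bounded (pinvmx J).
by exists C => // h; rewrite -[h in leLHS](mulmxKp fJ) HC.
Qed.

Definition ball_cover W x0 r l :=
  (forall b, b \in l -> b.1 \in W /\ 0 < b.2) /\
  forall w, w \in W -> enorm (w - x0) <= r ->
    exists2 b, b \in l & enorm (w - b.1) <= b.2.

(** Count the [N ^ d] points of a grid inside the unit ball: for [N] large, a ball of radius [b.2]
    contains at most [(c1 * b.2 * N) ^+ d] of them. Any positive constant will do, as
    [ball_cover_sum_ge1] improves it to 1. *)
Lemma ball_cover_sum_pos W :
  exists2 c, 0 < c & forall l, ball_cover W 0 1 l -> c <= \sum_(b <- l) b.2 ^+ (\dim W).
Proof.
set d := \dim W.
pose J : 'M[R]_(d, n) := \matrix_(i < d) (vbasis W)`_i.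
have hJ (h : 'rV_d) : h *m J = \sum_(i < d) h ord0 i *: (vbasis W)`_i.
  by rewrite mulmx_sum_row; apply: eq_bigr => i _; rewrite rowK.
have hJW (h : 'rV_d) : h *m J \in W.
  rewrite hJ; apply: memv_suml => i _; apply/memvZ/vbasis_mem/mem_nth.
  by rewrite size_tuple.
have fJ : row_free J.
  apply: inj_row_free => h; rewrite hJ => h0; apply/rowP => i; rewrite mxE.
  by have /freeP := basis_free (vbasisP W); apply.
have [C C0 HC] := row_free_lower_bound fJ.
have [A A0 HA] := enorm_mulmx_bounded J.
pose a := 1 / (A * (d%:R + 1)).
have dp : 0 < d%:R + 1 :> R by rewrite ltr_wpDl.
have a0 : 0 < a by rewrite divr_gt0// mulr_gt0.
(* Grid points in one ball are [2 * b.2] apart at most, hence their indices differ by at most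
   [m = c1 / 2 * b.2 * N]; the remaining factor 2 covers [trunc m + 1 <= 2 * m], valid once
   [1 <= m]. *)
pose c1 := 4 * C / a; have c10 : 0 < c1 by rewrite divr_gt0// mulr_gt0.
exists (c1^-1 ^+ d); first by rewrite exprn_gt0// invr_gt0.
move=> l [lW lc].
have [N N0 HN] : exists2 N, (0 < N)%N & forall b, b \in l -> 1 <= c1 / 2 * b.2 * N%:R.
  pose s := \sum_(b <- l | 0 < b.2) (c1 / 2 * b.2)^-1.
  exists (Num.bound s).+1 => // b bl; have [_ b0] := lW b bl.
  have cb : 0 < c1 / 2 * b.2 by rewrite mulr_gt0// divr_gt0.
  rewrite -ler_pdivrMl// mulr1; apply: (@le_trans _ _ s).
    rewrite /s (big_rem b)//= b0 lerDl sumr_ge0// => b' b'0.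
    by rewrite invr_ge0 mulr_ge0 ?(ltW b'0)// divr_ge0 ?(ltW c10).
  have s0 : 0 <= s.
    by apply: sumr_ge0 => b' b'0; rewrite invr_ge0 mulr_ge0 ?(ltW b'0)// divr_ge0 ?(ltW c10).
  by apply: (le_trans (ltW (archi_boundP s0))); rewrite ler_nat.
have Np : 0 < N%:R :> R by rewrite ltr0n.
pose h (k : {ffun 'I_d -> 'I_N}) : 'rV[R]_d := \row_j (a * ((k j)%:R / N%:R)).
have h1 k : enorm (h k *m J) <= 1.
  apply: le_trans (HA _) _; rewrite mulrC -ler_pdivlMr//.
  have hn : `|h k| <= a.
    rewrite [leLHS]/Num.Def.normr/= mx_normrE; apply: bigmax_le; first exact: ltW.
    move=> [i j] _ /=; rewrite mxE ger0_norm ?(mulr_ge0 (ltW a0))//.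
    by rewrite ler_piMr ?(ltW a0)// ler_pdivrMr// mul1r ler_nat ltnW.
  apply: le_trans (ler_enorm_norm _) _; apply: le_trans (ler_wpM2l (ler0n _ _) hn) _.
  rewrite /a !mul1r invfM mulrCA ler_piMr ?invr_ge0 ?(ltW A0)//.
  by rewrite ler_pdivrMr// mul1r lerDl.
pose S (b : 'rV[R]_n * R) := finset (fun k => enorm (h k *m J - b.1) <= b.2).
have cardS b : b \in l -> (#|S b|%:R : R) <= (c1 * b.2 * N%:R) ^+ d.
  move=> bl; have [_ b0] := lW b bl.
  set m := c1 / 2 * b.2 * N%:R; have m1 : 1 <= m := HN b bl.
  apply: (@le_trans _ _ ((Num.trunc m).+1 ^ d)%N%:R).
    rewrite ler_nat; apply: card_bounded_spread => k k' j; rewrite !inE => kS k'S.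
    have m0 : 0 <= m by lra.
    suff : ((k' j)%:R - (k j)%:R : R) <= m.
      move=> km; rewrite -leq_subLR truncn_ge_nat//.
      have [kk|kk] := leqP (k j) (k' j); first by rewrite natrB.
      by rewrite (eqP (_ : (k' j - k j == 0)%N)) ?mulr0n// subn_eq0 ltnW.
    have kk : enorm (h k' - h k) <= C * (2 * b.2).
      apply: le_trans (HC _) _; rewrite ler_wpM2l ?(ltW C0)// mulmxBl.
      rewrite (_ : _ - _ = (h k' *m J - b.1) - (h k *m J - b.1)); last by vec.
      by apply: le_trans (ler_enormB _ _) _; lra.
    have := le_trans (ler_coord_enorm _ j) kk; rewrite !mxE -mulrBr -mulrBl.
    move=> /(le_trans (ler_norm _)).
    rewrite /m /c1 mulrA ler_pdivrMr// mulrC -ler_pdivlMr// => /le_trans; apply.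
    by rewrite le_eqVlt; apply/orP; left; apply/eqP; field; rewrite gt_eqF.
  rewrite natrX; apply: lerXn2r; rewrite ?nnegrE//.
    by apply: mulr_ge0 => //; apply: mulr_ge0; exact: ltW.
  have tm : (Num.trunc m)%:R <= m by rewrite truncn_le; lra.
  by rewrite -natr1 (_ : c1 * b.2 * N%:R = 2 * m); [lra|rewrite /m; field].
have : (N ^ d)%N%:R <= \sum_(b <- l) (c1 * b.2 * N%:R) ^+ d.
  apply: (@le_trans _ _ (\sum_(b <- l) #|S b|%:R)).
    rewrite -natr_sum ler_nat.
    have -> : (N ^ d = \sum_(k : {ffun 'I_d -> 'I_N}) 1)%N.
      by rewrite sum1_card card_ffun !card_ord.
    under [leqRHS]eq_bigr do rewrite -sum1_card big_mkcond.
    rewrite exchange_big; apply: leq_sum => k _.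
    have [b bl kb] : exists2 b, b \in l & enorm (h k *m J - b.1) <= b.2.
      by apply: lc; rewrite ?subr0.
    by rewrite (big_rem b)//= inE kb.
  by rewrite !big_seq; apply: ler_sum => b bl; exact: cardS.
have -> : \sum_(b <- l) (c1 * b.2 * N%:R) ^+ d = c1 ^+ d * (\sum_(b <- l) b.2 ^+ d) * N%:R ^+ d.
  by rewrite mulr_sumr mulr_suml; apply: eq_bigr => b _; rewrite !exprMn.
rewrite natrX ler_pMl ?exprn_gt0// => H.
by rewrite exprVn -[leLHS]mulr1 ler_pdivrMl ?exprn_gt0.
Qed.

(** Replacing each ball of [l] by a copy of a cover [l'] scaled to it multiplies the two sums. The
    sums [q ^+ k] of iterated covers would tend to 0 if [q < 1], against the positive lower
    bound. *)
Lemma ball_cover_sum_ge1 W l : ball_cover W 0 1 l -> 1 <= \sum_(b <- l) b.2 ^+ (\dim W).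
Proof.
move=> lc; rewrite leNgt; apply/negP; set q := \sum_(b <- l) _ => q1.
have [c c0 Hc] := ball_cover_sum_pos W.
have q0 : 0 <= q.
  by rewrite /q big_seq sumr_ge0// => b bl; rewrite exprn_ge0// ltW//; case: (lc.1 b bl).
have iter k : exists2 l', ball_cover W 0 1 l' & \sum_(b <- l') b.2 ^+ (\dim W) = q ^+ k.
  elim: k => [|k [l' l'c l'q]].
    exists [:: (0, 1)]; last by rewrite big_seq1 expr1n.
    split=> [b|w _ w1]; first by rewrite inE => /eqP -> /=; rewrite mem0v.
    by exists (0, 1) => //; rewrite inE.
  exists [seq (b.1 + b.2 *: b'.1, b.2 * b'.2) | b <- l, b' <- l'].
    split=> [_ /allpairsP[[b b'] [/= bl bl' ->]]|w wW w1] /=.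
      have [bW b0] := lc.1 b bl; have [bW' b0'] := l'c.1 b' bl'.
      by rewrite memvD ?memvZ// mulr_gt0.
    have [b bl wb] := lc.2 w wW w1; have [bW b0] := lc.1 b bl.
    have [||b' bl' wb'] := l'c.2 (b.2^-1 *: (w - b.1)).
    - by rewrite memvZ// memvB.
    - by rewrite subr0 enormZ gtr0_norm ?invr_gt0// ler_pdivrMl// mulr1.
    exists (b.1 + b.2 *: b'.1, b.2 * b'.2); first by apply/allpairsP; exists (b, b').
    rewrite /= (_ : w - _ = b.2 *: (b.2^-1 *: (w - b.1) - b'.1)); last first.
      by rewrite scalerBr scalerA mulfV ?gt_eqF// scale1r opprD addrA.
    by rewrite enormZ gtr0_norm// ler_pM2l.
  rewrite big_allpairs_dep /= exprS -l'q mulr_suml; apply: eq_bigr => b _.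
  by rewrite mulr_sumr; apply: eq_bigr => b' _; rewrite exprMn.
have [k qk] : exists k, q ^+ k < c.
  have /cvgr0_norm_lt /(_ c c0) : q ^+ k @[k --> \oo] --> 0.
    by apply: cvg_expr; rewrite ger0_norm.
  move=> [k _ Hk]; exists k; have := Hk k (leqnn k).
  by apply: le_lt_trans; exact: ler_norm.
by have [l' l'c l'q] := iter k; have := Hc l' l'c; rewrite l'q leNgt qk.
Qed.

(* Rescaled copies of a cover of a ball cover the balls of that cover, so a sum
   smaller than [r ^+ d] could be iterated down to [0]. *)
Lemma ball_cover_sum W x0 r l : x0 \in W -> 0 < r -> ball_cover W x0 r l ->
  r ^+ (\dim W) <= \sum_(b <- l) b.2 ^+ (\dim W).
Proof.
move=> x0W r0 [lW lc].
have : ball_cover W 0 1 [seq (r^-1 *: (b.1 - x0), r^-1 * b.2) | b <- l].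
  split=> [_ /mapP[b bl ->] /=|w wW w1].
    by have [bW b0] := lW b bl; rewrite memvZ ?memvB// mulr_gt0// invr_gt0.
  have [||b bl wb] := lc (x0 + r *: w).
  - by rewrite memvD// memvZ.
  - by rewrite addrC addKr enormZ gtr0_norm// ler_piMr ?(ltW r0)//; rewrite subr0 in w1.
  exists (r^-1 *: (b.1 - x0), r^-1 * b.2); first by apply/mapP; exists b.
  rewrite /= (_ : w - _ = r^-1 *: (x0 + r *: w - b.1)); last first.
    rewrite (_ : x0 + r *: w - b.1 = r *: w - (b.1 - x0)); last by vec.
    by rewrite [RHS]scalerBr scalerA mulVf ?gt_eqF// scale1r.
  by rewrite enormZ gtr0_norm ?invr_gt0// ler_pM2l ?invr_gt0.
move=> /ball_cover_sum_ge1; rewrite big_map /=.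
under eq_bigr do rewrite exprMn.
by rewrite -mulr_sumr exprVn ler_pdivlMl ?exprn_gt0// mulr1.
Qed.

End BallCover.

(** * Lower bound for the Hausdorff measure *)

Section HausdorffLowerBound.
Context {R : realType}.

Lemma unit_ball_vol_gt0 d : 0 < unit_ball_vol d :> R.
Proof.
suff : 0 < unit_ball_vol d :> R /\ 0 < unit_ball_vol d.+1 :> R by case.
elim: d => [|d [d0 d1]]; first by rewrite /= ltr01 ltr0n.
by split=> //=; rewrite mulr_gt0// divr_gt0// mulr_gt0// pi_gt0.
Qed.

(** Lets a set of diameter [D] be placed in an open ball of slightly larger radius, as compactness
    requires, at arbitrarily small cost. *)
Lemma exprn_addr_close (D eta : R) d : 0 < eta -> exists2 e, 0 < e & (D + e) ^+ d <= D ^+ d + eta.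
Proof.
move=> eta0; have /cvgrPdist_le /(_ eta eta0) := @exprn_continuous R d D.
move=> [e /= e0 He]; exists (e / 2); first by rewrite divr_gt0.
have := He (D + e / 2); rewrite /ball_ /= opprD addrA subrr sub0r normrN.
rewrite ger0_norm ?divr_ge0 ?(ltW e0)// => /(_ _); rewrite gtr_pMr// invf_lt1// ltr1n.
by move=> /(_ isT); rewrite ler_norml => /andP[+ _]; lra.
Qed.

Lemma ler_sum_uniq_nat (s : seq nat) (P : pred nat) (F : nat -> R) K :
  uniq s -> (forall i, i \in s -> P i && (i < K)%N) -> (forall i, 0 <= F i) ->
  \sum_(i <- s) F i <= \sum_(0 <= i < K | P i) F i.
Proof.
move=> us sP F0; rewrite [leRHS](bigID (mem s)) /=.
rewrite (_ : \sum_(i <- s) F i = \sum_(0 <= i < K | P i && (i \in s)) F i) ?lerDl ?sumr_ge0//.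
rewrite -[RHS]big_filter; apply: perm_big; apply: uniq_perm => //.
  by rewrite filter_uniq// iota_uniq.
move=> i; rewrite mem_filter mem_index_iota /=.
by apply/idP/idP => [is_|/andP[/andP[]]//]; have /andP[-> ->] := sP i is_; rewrite is_.
Qed.

Context {n : nat}.

Lemma vspace_ecball_compact (W : {vspace 'rV[R]_n}) c r :
  compact ([set w | w \in W] `&` ecball c r).
Proof.
apply: (@subclosed_compact _ _ (ecball c r)); last 2 first.
- exact: ecball_compact.
- by move=> x [].
apply: closedI; last exact: ecball_closed.
rewrite (_ : mkset _ = (fun w => enorm (w - oproj (vsset W) w)) @^-1` [set t | t = 0]).
  apply: closed_comp (@closed_eq R 0) => y _.
  apply: (@enorm_lip_continuous _ _ _ 1) => u v; rewrite mul1r.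
  apply: le_trans (ler_enormB_dist _ _) _.
  rewrite (_ : _ - _ = (u - v) - oproj (vsset W) (u - v)); last by rewrite oprojB; vec.
  by apply: le_trans (enorm_oproj_min _ (mem0v W)) _; rewrite subr0.
apply/seteqP; split=> w /=; first by move=> wW; rewrite oproj_id// subrr enorm0.
by move=> /enorm_eq0/subr0_eq ->; exact: mem_oproj.
Qed.

Lemma diam_ge0 (C : set 'rV[R]_n) : (0%:E <= diam C)%E.
Proof. by apply: ereal_sup_ubound; right. Qed.

Lemma eudist_le_diam (C : set 'rV[R]_n) del x y : (diam C < del%:E)%E -> C x -> C y ->
  eudist x y <= fine (diam C).
Proof.
move=> Cd Cx Cy; rewrite -lee_fin fineK.
  by apply: ereal_sup_ubound; left; exists x => //; exists y.
by rewrite ge0_fin_numE ?diam_ge0//; apply: lt_trans Cd (ltry _).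
Qed.

Lemma hcontent_ge0 d (C : set 'rV[R]_n) : (0%:E <= hcontent d C)%E.
Proof.
rewrite /hcontent; case: pselect => //= _; rewrite lee_fin mulr_ge0 ?(ltW (unit_ball_vol_gt0 d))//.
by rewrite exprn_ge0// divr_ge0// fine_ge0// diam_ge0.
Qed.

Definition projects_onto_ball d r (A : set 'rV[R]_n) : Prop :=
  exists W c, [/\ \dim W = d, c \in W & forall w, w \in W -> enorm (w - c) <= r ->
    exists2 x, A x & oproj (vsset W) x = w].

(** Projections do not increase distances, so the projection of [C i] lies in the open ball of
    radius [rad i] around that of any of its points. Compactness leaves finitely many balls, to
    which [ball_cover_sum] applies. The bound holds for all large [K], so that one [K] can serve
    several sets [A]. *)
Lemma projects_onto_ball_cover d r (A : set 'rV[R]_n) (C : nat -> set 'rV[R]_n) (rad : nat -> R) :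
  0 < r -> projects_onto_ball d r A -> A `<=` \bigcup_i C i ->
  (forall i, 0 <= rad i) ->
  (forall i x y, C i x -> C i y -> eudist x y < rad i) ->
  exists K0, forall K, (K0 <= K)%N ->
    r ^+ d <= \sum_(0 <= i < K | `[< (C i `&` A) !=set0 >]) rad i ^+ d.
Proof.
move=> r0 [W [c [dW cW onto]]] AC rad0 Crad.
pose P i := (C i `&` A) !=set0.
have /choice[x Hx] : forall i, exists x, P i -> C i x /\ A x.
  move=> i; have [[x [Cx Ax]]|nP] := pselect (P i); first by exists x.
  by exists 0 => /nP.
have cB := @vspace_ecball_compact W c r.
rewrite compact_cover in cB.
have [||D' D'P D'c] := cB nat P (fun i => eball (oproj (vsset W) (x i)) (rad i)).
- by move=> i _; exact: eball_open.
- move=> w [wW wr]; have [y Ay yw] := onto w wW wr; have [i _ Ciy] := AC y Ay.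
  have Pi : P i by exists y.
  exists i => //; have [Cx _] := Hx i Pi.
  rewrite /eball /= /eudist -yw -oprojB; apply: le_lt_trans (enorm_oproj _ _) _.
  exact: Crad Ciy Cx.
exists (\max_(i <- finmap.enum_fset D') i).+1 => K K0K.
have sD i : i \in finmap.enum_fset D' -> P i /\ (i < K)%N.
  move=> iD; split; first exact: set_mem (D'P i iD).
  by apply: leq_trans K0K; rewrite ltnS; exact: leq_bigmax_seq.
apply: (@le_trans _ _ (\sum_(i <- finmap.enum_fset D') rad i ^+ d)); last first.
  apply: ler_sum_uniq_nat.
  - exact: finmap.fset_uniq.
  - by move=> i /sD[Pi ->]; rewrite andbT; apply/asboolP.
  - by move=> i; rewrite exprn_ge0.
have := @ball_cover_sum R n W c r [seq (oproj (vsset W) (x i), rad i) | i <- finmap.enum_fset D'] cW r0.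
rewrite dW big_map; apply; split=> [_ /mapP[i iD ->] /=|w wW wr].
  split; first exact: mem_oproj.
  have [Pi _] := sD i iD; have [Cx _] := Hx i Pi.
  by have := Crad _ _ _ Cx Cx; rewrite eudistxx.
have [i iD wi] := D'c w (conj wW wr).
exists (oproj (vsset W) (x i), rad i); first by apply/mapP; exists i.
exact: ltW wi.
Qed.

Lemma sum_half_geometric K : \sum_(0 <= i < K) 2^-1 ^+ i.+1 <= 1 :> R.
Proof.
suff -> : \sum_(0 <= i < K) 2^-1 ^+ i.+1 = 1 - 2^-1 ^+ K :> R.
  by rewrite lerBlDr lerDl exprn_ge0.
elim: K => [|K IH]; first by rewrite big_geq// expr0 subrr.
by rewrite big_nat_recr//= IH exprS; field.
Qed.

(** A set of diameter below [del] meets at most one [A j], so the sums obtained for the various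
    [A j] run over disjoint indices. A covering set of diameter [D] counts as a ball of radius [D]
    in the covering bound but as [D / 2] in [hcontent], hence [r / 2]. *)
Lemma hausdorff_separated_ge (I : finType) d del r (M : set 'rV[R]_n) (A : I -> set 'rV[R]_n) :
  0 < del -> 0 < r -> (forall i, A i `<=` M) -> (forall i, projects_onto_ball d r (A i)) ->
  (forall i j x y, i != j -> A i x -> A j y -> del <= eudist x y) ->
  ((#|I|%:R * (unit_ball_vol d * (r / 2) ^+ d))%:E <= hausdorff d M)%E.
Proof.
move=> del0 r0 AM Aonto Asep.
apply: (@le_trans _ _ (hausdorff_approx d del M)); last first.
  by apply: ereal_sup_ubound; exists del.
apply/ereal_infP => _ [C [MC Cdel] <-].
set V := unit_ball_vol d : R; have V0 : 0 < V := unit_ball_vol_gt0 d.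
pose D i := fine (diam (C i)).
have D0 i : 0 <= D i by rewrite fine_ge0// diam_ge0.
apply/lee_addgt0Pr => e e0.
have Vd0 : 0 < V / 2 ^+ d by rewrite divr_gt0// exprn_gt0.
pose e' := e / (V / 2 ^+ d); have e'0 : 0 < e' by rewrite divr_gt0.
(* Error budget: enlarging the [i]-th radius costs at most [e' / 2 ^ (i + 1)], in total at most
   [e']. *)
have /choice[rho Hrho] : forall i, exists rho, 0 < rho /\
    (D i + rho) ^+ d <= D i ^+ d + e' * 2^-1 ^+ i.+1.
  move=> i; have [|rho rho0 H] := @exprn_addr_close (D i) (e' * 2^-1 ^+ i.+1) d.
    by rewrite mulr_gt0// exprn_gt0// invr_gt0.
  by exists rho.
pose rad i := D i + rho i.
have rad0 i : 0 <= rad i by rewrite addr_ge0// ltW//; case: (Hrho i).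
have Crad i x y : C i x -> C i y -> eudist x y < rad i.
  move=> Cx Cy; apply: le_lt_trans (eudist_le_diam (Cdel i) Cx Cy) _.
  by rewrite ltrDl; case: (Hrho i).
have /choice[K0 HK0] : forall j, exists K0, forall K, (K0 <= K)%N ->
    r ^+ d <= \sum_(0 <= i < K | `[< (C i `&` A j) !=set0 >]) rad i ^+ d.
  move=> j; apply: projects_onto_ball_cover => //.
  exact: subset_trans (AM j) MC.
pose K := (\max_j K0 j)%N.
(* The empty set is singled out because [D i ^+ d] is 1, not 0, when [d] is 0. *)
pose f i : R := if pselect (C i = set0) then 0 else D i ^+ d.
have hf i : hcontent d (C i) = (V / 2 ^+ d * f i)%:E.
  rewrite /hcontent /f; case: pselect => /= _; first by rewrite mulr0.
  by rewrite expr_div_n -/(D i) -/V; congr _%:E; field; rewrite expf_neq0.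
have main : #|I|%:R * r ^+ d <= \sum_(0 <= i < K) f i + e'.
  apply: (@le_trans _ _ (\sum_(j : I) \sum_(0 <= i < K | `[< (C i `&` A j) !=set0 >]) rad i ^+ d)).
    rewrite mulr_natl -sumr_const; apply: ler_sum => j _.
    by apply: HK0; exact: leq_bigmax.
  apply: (@le_trans _ _ (\sum_(0 <= i < K) (f i + e' * 2^-1 ^+ i.+1))); last first.
    by rewrite big_split/= lerD2l -mulr_sumr ler_piMr ?(ltW e'0)// sum_half_geometric.
  under eq_bigr do rewrite big_mkcond.
  rewrite exchange_big; apply: ler_sum => i _; rewrite -big_mkcond /=.
  have pos : 0 <= e' * 2^-1 ^+ i.+1 by rewrite mulr_ge0 ?(ltW e'0)// exprn_ge0.
  have [[j /asboolP ij]|none] := pselect (exists j, `[< (C i `&` A j) !=set0 >]); last first.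
    rewrite big1 => [|j ij]; last by case: none; exists j.
    by rewrite addr_ge0// /f; case: pselect => //= _; rewrite exprn_ge0.
  rewrite (big_pred1 j) => [|j' /=].
    have [_ Hi] := Hrho i; apply: le_trans Hi _; rewrite lerD2r /f.
    by case: pselect => //= Ci0; case: ij => x [] /=; rewrite Ci0.
  apply/asboolP/eqP => [[y [Cy Ay]]|-> //]; apply/eqP/negPn/negP => jj'.
  have [x [Cx Ax]] := ij.
  have := eudist_le_diam (Cdel i) Cy Cx; have := Asep _ _ _ _ jj' Ay Ax.
  have : fine (diam (C i)) < del.
    rewrite -lte_fin fineK ?Cdel// ge0_fin_numE ?diam_ge0//.
    exact: lt_trans (Cdel i) (ltry _).
  lra.
apply: (@le_trans _ _ ((\sum_(0 <= i < K) hcontent d (C i)) + e%:E)%E); last first.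
  by rewrite leeD2r// nneseries_lim_ge// => i _ _; exact: hcontent_ge0.
under eq_bigr do rewrite hf.
rewrite sumEFin -EFinD lee_fin -mulr_sumr.
have -> : e = V / 2 ^+ d * e' by rewrite /e' mulrC divfK// gt_eqF.
rewrite -mulrDr; apply: le_trans (ler_wpM2l (ltW Vd0) main).
by rewrite expr_div_n le_eqVlt; apply/orP; left; apply/eqP; field; rewrite expf_neq0.
Qed.

End HausdorffLowerBound.

(** * Separated finite sets and the operator norm *)

Section FiniteSets.
Context {R : realType} {n : nat}.
Implicit Types (x y z : 'rV[R]_n) (l : seq 'rV[R]_n).

(** Nonemptiness matters: [inf] of the empty set is 0. *)
Lemma dist_seq_lt z l a : l != [::] -> dist_set z [set y | y \in l] < a ->
  exists2 y, y \in l & eudist z y < a.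
Proof.
move=> l0 za; apply: contrapT => none; move: za; apply/negP; rewrite -leNgt.
have l0' : [set y | y \in l] !=set0.
  by case: l l0 {none} => // y l _; exists y; rewrite /= mem_head.
apply: dist_set_ge => // y /= yl; rewrite leNgt; apply/negP => h.
by apply: none; exists y => //; rewrite eudistC.
Qed.

Lemma eudist_perturb x y p q e : eudist p x <= e -> eudist q y <= e ->
  eudist x y - 2 * e <= eudist p q.
Proof.
have := eudist_trans p x y; have := eudist_trans q p y; rewrite (eudistC x p).
move: (eudist x y) (eudist p x) (eudist q y) (eudist p y) (eudist p q) => *; lra.
Qed.

Lemma opnorm_oproj_le (W T : {vspace 'rV[R]_n}) s v :
  opnorm (fun v => oproj (vsset W) v - oproj (vsset T) v) <= s ->
  enorm (oproj (vsset W) v - oproj (vsset T) v) <= s * enorm v.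
Proof.
move=> Hs; have [->|v0] := eqVneq v 0.
  by rewrite !oproj_id ?mem0v// subrr enorm0 mulr0.
pose f u := oproj (vsset W) u - oproj (vsset T) u.
have fZ a u : f (a *: u) = a *: f u by rewrite /f !oprojZ scalerBr.
have := enorm_gt0 v0 => V0.
rewrite -/(f v) -ler_pdivrMr// mulrC -[X in X * _]gtr0_norm ?invr_gt0// -enormZ -fZ.
apply: le_trans Hs; apply: sup_upper_bound.
  split; first by exists (enorm (f 0)), 0; rewrite /= ?enorm0.
  exists 2 => _ [u /= u1 <-]; apply: le_trans (ler_enormB _ _) _.
  by have := enorm_oproj W u; have := enorm_oproj T u; lra.
by exists ((enorm v)^-1 *: v); rewrite //= enorm_unit.
Qed.

Definition pairwise_far (s : R) l := forall x y, x \in l -> y \in l -> x != y -> s <= eudist x y.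

(** Cover [M] by finitely many balls of radius [(s - 2 * eta) / 2]. Two points of [l] whose
    projections share a ball would be closer than [s], so [l] injects into the centers. *)
Lemma pairwise_far_size_bounded (M : set 'rV[R]_n) eta s : compact M -> M !=set0 -> 2 * eta < s ->
  exists K, forall l, uniq l -> pairwise_far s l ->
    (forall x, x \in l -> dist_set x M <= eta) -> (size l <= K)%N.
Proof.
move=> cM M0 es.
have e0 : 0 < (s - 2 * eta) / 2 by rewrite divr_gt0// subr_gt0.
have := cM; rewrite compact_cover => /(_ 'rV[R]_n M (fun p => eball p ((s - 2 * eta) / 2))).
move=> [||D' _ D'c]; first by move=> p _; exact: eball_open.
  by move=> p Mp; exists p => //; rewrite /eball /= eudistxx.
have /choice[f Hf] : forall x, exists q, q \in finmap.enum_fset D' /\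
    eudist (nproj M x) q < (s - 2 * eta) / 2.
  by move=> x; have [q qD H] := D'c _ (nproj_in M0 cM x); exists q.
exists (size (finmap.enum_fset D')) => l ul ls lM.
have finj : {in l &, injective f}.
  move=> x y xl yl fxy; apply/eqP/negPn/negP => xy.
  have [_ Hx] := Hf x; have [_ Hy] := Hf y; rewrite fxy in Hx.
  have := lM x xl; have := lM y yl; rewrite -!(eudist_nproj M0 cM) => ey ex.
  have := eudist_perturb ex ey; have := ls x y xl yl xy.
  have := eudist_trans (f y) (nproj M x) (nproj M y); rewrite (eudistC (f y) (nproj M y)).
  move: (eudist x y) (eudist _ (nproj M y)) (eudist _ (f y)) (eudist _ (f y)) Hx Hy => *; lra.
rewrite -(size_map f); apply: uniq_leq_size; first by rewrite map_inj_in_uniq.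
by move=> _ /mapP[x _ ->]; case: (Hf x).
Qed.

End FiniteSets.

(** * The for loop over a packing *)

Section InnerLoop.
Context {R : realType} {n : nat}.
Implicit Types (x y z v : 'rV[R]_n) (O Q vs : seq 'rV[R]_n).
Variables (pihat : 'rV[R]_n -> 'rV[R]_n) (Delta delta sigma tau : R).

(** A point is added only when [x + Delta *: v] is [delta]-far from all others; [pihat] moves it by
    at most [tau], which leaves [delta - tau >= sigma]. When nothing is added, a current point is
    already within [delta]. Either way the direction [v] is covered. *)
Lemma mp_inner_spec (good : 'rV[R]_n -> Prop) x O Q vs :
  0 < sigma -> sigma + tau <= delta -> Q != [::] ->
  (forall v, v \in vs -> good (pihat (x + Delta *: v)) /\
     eudist (x + Delta *: v) (pihat (x + Delta *: v)) <= tau) ->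
  uniq (Q ++ O) -> pairwise_far sigma (Q ++ O) -> (forall y, y \in Q ++ O -> good y) ->
  let Q' := mp_inner pihat Delta delta x O Q vs in
  [/\ uniq (Q' ++ O), pairwise_far sigma (Q' ++ O), (forall y, y \in Q' ++ O -> good y),
      {subset Q <= Q'} &
      forall v, v \in vs -> exists2 y, y \in Q' ++ O & eudist (x + Delta *: v) y <= delta].
Proof.
move=> s0 std; rewrite /mp_inner.
elim: vs Q => [|v vs IH] Q Q0 Hv uQ sQ gQ; first by split.
set z := x + Delta *: v; have [gz zt] := Hv v (mem_head _ _); rewrite -/z in gz zt.
have Hvs v' : v' \in vs -> good (pihat (x + Delta *: v')) /\
     eudist (x + Delta *: v') (pihat (x + Delta *: v')) <= tau.
  by move=> v'vs; apply: Hv; rewrite inE v'vs orbT.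
have td : tau <= delta by rewrite (le_trans _ std)// lerDr ltW.
simpl foldl; case: ifP => [zd|/negbT].
  have far y : y \in Q ++ O -> sigma <= eudist (pihat z) y.
    move=> yQ; have := le_trans zd (dist_set_le z yQ); rewrite eudistC => zy.
    by have := eudist_trans (pihat z) z y; lra.
  have nz : pihat z \notin Q ++ O.
    by apply/negP => /far; rewrite eudistxx leNgt s0.
  have [|||uQ' sQ' gQ' QQ' cQ'] := IH (pihat z :: Q) isT Hvs.
  - by rewrite /= nz.
  - move=> a b; rewrite !inE => /predU1P[->|aQ] /predU1P[->|bQ].
    + by rewrite eqxx.
    + by move=> _; exact: far.
    + by move=> _; rewrite eudistC; exact: far.
    + exact: sQ.
  - by move=> y; rewrite inE => /predU1P[->|/gQ].
  split=> //; first by move=> y yQ; apply: QQ'; rewrite inE yQ orbT.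
  move=> v'; rewrite inE => /predU1P[->|/cQ' //]; exists (pihat z).
    by rewrite mem_cat QQ' ?mem_head.
  exact: le_trans zt td.
rewrite -ltNge => zd; have QO0 : Q ++ O != [::] by case: (Q) Q0.
have [uQ' sQ' gQ' QQ' cQ'] := IH Q Q0 Hvs uQ sQ gQ.
split=> // v'; rewrite inE => /predU1P[->|/cQ' //].
have [y yQ zy] := dist_seq_lt QO0 zd; exists y; last exact: ltW.
by move: yQ; rewrite !mem_cat => /orP[/QQ' ->|->]; rewrite ?orbT.
Qed.

End InnerLoop.

(** * The loop invariant and termination *)

Section Propagation.
Context {R : realType} {n d : nat}.
Variables (rchmin : R) (M : set 'rV[R]_n)
  (x0 : 'rV[R]_n) (That : 'rV[R]_n -> {vspace 'rV[R]_n})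
  (pihat : 'rV[R]_n -> 'rV[R]_n)
  (Delta delta alpha eta Lambda theta : R).
Hypotheses (Mclass : manifold_class d rchmin M)
  (Delta0 : 0 < Delta)
  (x0M : dist_set x0 M <= eta)
  (Hangle : forall x, dist_set x M <= eta ->
     opnorm (fun v => oproj (tangent_space M (nproj M x)) v - oproj (vsset (That x)) v)
       <= sin theta)
  (Hpihat : forall x, dist_set x M <= Lambda -> eudist (nproj M x) (pihat x) <= eta)
  (etaD : 64 * eta <= Delta) (DR : Delta <= rchmin / 24)
  (sina : sin alpha <= 1 / 64) (sint : sin theta <= 1 / 64)
  (HL : 5 * Delta ^+ 2 / (8 * rchmin) + eta + Delta * sin theta <= Lambda)
  (delta1 : 3 * Delta / 10 <= delta) (delta2 : delta <= 7 * Delta / 10).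

Let M0 : M !=set0. Proof. by case: Mclass. Qed.
Let cM : compact M. Proof. by case: Mclass. Qed.
Let rM : (rchmin%:E <= rch M)%E. Proof. by case: Mclass. Qed.
Let rch0 : 0 < rchmin. Proof. by have := Delta0; have := DR; lra. Qed.

Lemma manifold_class_tangent p : M p -> exists W,
  [/\ \dim W = d, approximates M p W & tangent_space M p = vsset W].
Proof.
move=> Mp; have [_ _ _ CM _] := Mclass.
have [W [dW AW tW]] := C2_submanifold_approximates CM Mp; exists W; split=> //.
by apply/seteqP; split=> v; [exact: tangent_space_approximates|exact: tW].
Qed.

Let HM p : M p -> exists W, approximates M p W.
Proof. by move=> /manifold_class_tangent[W [_ AW _]]; exists W. Qed.

(** With [u] the projection of [v] to the true tangent space at [p], the three terms bound the
    distance from [p + Delta *: u] to [M], the offset from [x] to [p], and the tilt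
    [Delta *: (u - v)]. *)
Lemma tangent_step_dist x v : dist_set x M <= eta -> v \in That x -> enorm v = 1 ->
  dist_set (x + Delta *: v) M <= 5 * Delta ^+ 2 / (8 * rchmin) + eta + Delta * sin theta.
Proof.
move=> xM vT v1; have := rch0; have := Delta0; have := DR => DR' D0 r0.
have [W [_ AW tW]] := manifold_class_tangent (nproj_in M0 cM x).
have := Hangle xM; rewrite tW => /(opnorm_oproj_le v).
rewrite (oproj_id vT) v1 mulr1; set u := oproj _ v; set p := nproj M x in AW * => uv.
have u1 : enorm u <= 1 by rewrite -v1; exact: enorm_oproj.
have Du : enorm (Delta *: u) <= Delta by rewrite enormZ gtr0_norm// ler_piMr// ltW.
have uW : Delta *: u \in W by rewrite memvZ// mem_oproj.
have [q Mq Hq] := tangent_dist_le cM rch0 rM HM (nproj_in M0 cM x) AW uW (le_trans Du DR').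
apply: le_trans (dist_set_le _ Mq) _; rewrite /eudist.
rewrite (_ : q - _ = (q - p - Delta *: u) + (p - x) + Delta *: (u - v)); last by vec.
apply: le_trans (ler_enormD _ _) _; apply: lerD; last first.
  by rewrite enormZ gtr0_norm// ler_wpM2l// ltW.
apply: le_trans (ler_enormD _ _) _; apply: lerD; last first.
  by rewrite -/(eudist p x) (eudist_nproj M0 cM).
apply: le_trans Hq _; rewrite ler_wpM2r ?invr_ge0 ?mulr_ge0 ?(ltW r0)//.
rewrite ler_wpM2l// ler_sqr ?nnegrE ?enorm_ge0//; exact: ltW.
Qed.

(** The displacement is at most the bound of [tangent_step_dist] plus [eta]; in units of [Delta]
    this is 5/192 + 3/64 = 7/96. *)
Lemma tangent_step_projection x v : dist_set x M <= eta -> v \in That x -> enorm v = 1 ->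
  dist_set (pihat (x + Delta *: v)) M <= eta /\
  eudist (x + Delta *: v) (pihat (x + Delta *: v)) <= 7 * Delta / 96.
Proof.
move=> xM vT v1; have zM := tangent_step_dist xM vT v1.
set z := x + _ in zM *.
have zp := Hpihat (le_trans zM HL); split.
  exact: le_trans (dist_set_le _ (nproj_in M0 cM z)) zp.
apply: le_trans (eudist_trans (nproj M z) _ _) _.
rewrite eudistC (eudist_nproj M0 cM).
have D0 := Delta0; have r0 := rch0; have etaD' := etaD; have DR' := DR; have sint' := sint.
have : 5 * Delta ^+ 2 / (8 * rchmin) <= 5 / 192 * Delta.
  rewrite ler_pdivrMr ?mulr_gt0//; have := ler_wpM2l (ltW D0) DR'; rewrite expr2; lra.
have := ler_wpM2l (ltW D0) sint'; lra.
Qed.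

(** The separation [3 * delta / 4] is what the displacement [7 * Delta / 96] leaves of [delta], as
    [Delta <= 10 / 3 * delta]. The last field remembers the packing used at each processed point, to
    be exploited once the queue is empty. *)
Record mp_inv (s : mp_state n) : Prop := MPInv {
  mp_inv_uniq : uniq (mpQ s ++ mpO s);
  mp_inv_far : pairwise_far (3 * delta / 4) (mpQ s ++ mpO s);
  mp_inv_dist : forall y, y \in mpQ s ++ mpO s -> dist_set y M <= eta;
  mp_inv_neq0 : mpQ s ++ mpO s != [::];
  mp_inv_size : size (mpO s) = mpN s;
  mp_inv_T : mpT s = [seq That x | x <- mpO s];
  mp_inv_cover : forall x, x \in mpO s -> exists2 vs, max_packing (That x) (sin alpha) vs &
     forall v, v \in vs -> exists2 y, y \in mpQ s ++ mpO s & eudist (x + Delta *: v) y <= delta }.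

Lemma mp_inv_init : mp_inv (mp_init x0).
Proof.
split=> //= [x y|y]; rewrite !inE; last by move=> /eqP ->.
by move=> /eqP -> /eqP ->; rewrite eqxx.
Qed.

Lemma mp_inv_step s s' : mp_inv s -> mp_step That pihat Delta delta alpha s s' -> mp_inv s'.
Proof.
move=> [+ + + + + + +] st; case: st => Q O TO N x vs xQ pvs /= uQ sQ gQ QO0 sizeO TE cov.
have D0 := Delta0; have d1 := delta1.
have xM : dist_set x M <= eta by apply: gQ; rewrite mem_cat xQ.
have [_ vsT _ _] := pvs.
have Q0 : Q != [::] by case: (Q) xQ.
have sig0 : 0 < 3 * delta / 4 by lra.
have std : 3 * delta / 4 + 7 * Delta / 96 <= delta by lra.
have Hv v : v \in vs -> dist_set (pihat (x + Delta *: v)) M <= eta /\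
    eudist (x + Delta *: v) (pihat (x + Delta *: v)) <= 7 * Delta / 96.
  by move=> /vsT[vT v1]; exact: tangent_step_projection.
have [] := mp_inner_spec (good := fun y => dist_set y M <= eta) sig0 std Q0 Hv uQ sQ gQ.
set Q' := mp_inner _ _ _ _ _ _ _ => uQ' sQ' gQ' QQ' cQ'.
have xQ' : x \in Q' by exact: QQ'.
(* [x] only moves from queue to output: [Q'] has no duplicates, so the filter removes a single
   copy. *)
have perm : perm_eq (Q' ++ O) ([seq y <- Q' | y != x] ++ x :: O).
  rewrite (perm_trans (y := (x :: rem x Q') ++ O)) ?perm_cat2r ?perm_to_rem//.
  rewrite rem_filter; last by move: uQ'; rewrite cat_uniq => /and3P[].
  by rewrite -cat1s -[x :: O]cat1s -catA perm_catCA.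
have mE := perm_mem perm.
split=> //=.
- by rewrite -(perm_uniq perm).
- by move=> a b; rewrite -!mE; exact: sQ'.
- by move=> a; rewrite -mE; exact: gQ'.
- by rewrite -size_eq0 -(perm_size perm) size_eq0; case: (Q') xQ'.
- by rewrite sizeO.
- by rewrite TE.
move=> y; rewrite inE => /predU1P[->|yO].
  by exists vs => // v /cQ'[z zQ Hz]; exists z; rewrite -?mE.
have [ws pws Hws] := cov y yO; exists ws => // v /Hws[z zQ Hz]; exists z => //.
by rewrite -mE; move: zQ; rewrite !mem_cat => /orP[/QQ' ->|->]; rewrite ?orbT.
Qed.

Lemma mp_inv_reach s : mp_reach That pihat Delta delta alpha (mp_init x0) s -> mp_inv s.
Proof. by elim=> [|s1 s2 _ IH]; [exact: mp_inv_init|exact: mp_inv_step]. Qed.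

(** Each iteration adds one point to the output, and separation together with compactness bounds its
    size by some [K]; [K - size (mpO s)] decreases. *)
Lemma mp_terminates : Acc (fun s' s => mp_step That pihat Delta delta alpha s s') (mp_init x0).
Proof.
have D0 := Delta0; have d1 := delta1; have eD := etaD.
have [|K HK] := @pairwise_far_size_bounded R n M eta (3 * delta / 4) cM M0; first by lra.
suff H k s : mp_inv s -> (K - size (mpO s) <= k)%N ->
    Acc (fun s' s => mp_step That pihat Delta delta alpha s s') s.
  exact: (H _ _ mp_inv_init (leqnn _)).
elim: k s => [|k IH] s Is Ks; constructor => s' st.
all: have Is' := mp_inv_step Is st.
all: have sK : (size (mpO s') <= K)%N
  by apply: leq_trans (HK _ (mp_inv_uniq Is') (mp_inv_far Is') (mp_inv_dist Is'));
     rewrite size_cat leq_addl.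
all: have sS : size (mpO s') = (size (mpO s)).+1 by case: st.
  by move: Ks; rewrite leqn0 subn_eq0 => /(leq_trans sK); rewrite sS ltnn.
apply: IH => //; rewrite sS subnS.
by case: (K - size (mpO s))%N Ks.
Qed.

(** * Properties of the output *)

Section Output.
Variable s : @mp_state R n.
Hypotheses (Is : mp_inv s) (Q0 : mpQ s = [::]).

(** The pieces of [M] in balls of radius [delta / 4] around the projected output points are
    [delta / 8] apart, and each projects onto a tangent ball of radius [delta / 16], as 49/400
    exceeds 1/16. Halving this radius gives [delta / 32]. *)
Lemma mp_output_card :
  ((mpN s)%:R%:E <= hausdorff d M * ((unit_ball_vol d * (delta / 32) ^+ d)^-1)%:E)%E.
Proof.
have [uO sO gO _ sizeO _ _] := Is; rewrite Q0 /= in uO sO gO.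
have D0 := Delta0; have d1 := delta1; have d2 := delta2; have eD := etaD; have DR' := DR.
have de0 : 0 < delta by lra.
have sep0 : delta / 8 + 2 * (delta / 4) + 2 * eta <= 3 * delta / 4 by lra.
rewrite lee_pdivlMr ?mulr_gt0 ?unit_ball_vol_gt0 ?exprn_gt0 ?divr_gt0//.
rewrite -EFinM.
pose p (i : 'I_(mpN s)) := nproj M (nth 0 (mpO s) i).
have Mp i : M (p i) := nproj_in M0 cM _.
have pd (i : 'I_(mpN s)) : eudist (p i) (nth 0 (mpO s) i) <= eta.
  by rewrite (eudist_nproj M0 cM) gO// mem_nth// sizeO.
have -> : delta / 32 = delta / 16 / 2 by field.
rewrite -[mpN s in leLHS]card_ord.
apply: (@hausdorff_separated_ge _ _ _ d (delta / 8) _ M (fun i => M `&` ecball (p i) (delta / 4))).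
- by rewrite divr_gt0.
- by rewrite divr_gt0.
- by move=> i x [].
- move=> i; have [W [dW AW _]] := manifold_class_tangent (Mp i).
  exists W, (oproj (vsset W) (p i)); split=> //; first exact: mem_oproj.
  move=> w wW wr.
  have [||||q [Mq qp Pq]] := @projection_covers R n M rchmin cM rch0 rM HM (p i) W (delta / 4)
    (w - oproj (vsset W) (p i)) (Mp i) AW.
  + by rewrite divr_gt0.
  + lra.
  + by rewrite memvB// mem_oproj.
  + lra.
  exists q; first by split.
  by move: Pq; rewrite oprojB => /(congr1 (fun u => u + oproj (vsset W) (p i))); rewrite !subrK.
- move=> i j x y ij [_ xi] [_ yj].
  have xi' : eudist x (p i) <= delta / 4 := xi.
  have yj' : eudist y (p j) <= delta / 4 := yj.
  apply: le_trans (eudist_perturb xi' yj'); rewrite lerBrDr.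
  apply: le_trans (eudist_perturb (pd i) (pd j)); rewrite lerBrDr.
  apply: le_trans sep0 _.
  by apply: sO; rewrite ?mem_nth ?sizeO// nth_uniq ?sizeO.
Qed.

(* Follow the estimated tangent space at [x] towards [p]: some direction of the
   packing points almost to [p], and the point found there is closer to [p]. *)
Lemma mp_output_closer p x : M p -> x \in mpO s -> eudist p (nproj M x) <= 101 / 100 * Delta ->
  exists2 y, y \in mpO s & eudist p (nproj M y) <= 95 / 100 * Delta.
Proof.
have [_ _ gO _ _ _ cov] := Is; rewrite Q0 /= in gO cov.
have D0 := Delta0; have d1 := delta1; have d2 := delta2; have eD := etaD; have DR' := DR.
have sa := sina; have st := sint; have r0 := rch0.
move=> Mp xO px.
(* If [x] is already close enough it serves itself; otherwise [p] is at distance nearly [Delta] from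
   [px0], and a step of length [Delta] towards it ends nearby. *)
have /orP[h|h] := le_total (eudist p (nproj M x)) (95 / 100 * Delta).
  by exists x; [exact: xO|exact: h].
have xM := gO x xO.
have [W [_ AW tW]] := manifold_class_tangent (nproj_in M0 cM x).
have := Hangle xM; rewrite tW => Hop.
have := normal_part_le cM rch0 rM (nproj_in M0 cM x) AW Mp.
set px0 := nproj M x in px h AW tW Hop *.
set w := oproj (vsset W) (p - px0); set w' := oproj (vsset (That x)) w.
rewrite -/(eudist p px0); set D := eudist p px0 in px h * => Hw.
have Hw1 : enorm (p - px0 - w) <= 22 / 1000 * Delta.
  have DD : D * D <= (101 / 100 * Delta) * (101 / 100 * Delta).
    by apply: ler_pM => //; exact: eudist_ge0.
  rewrite -(ler_pM2l (_ : 0 < 2 * rchmin)) ?mulr_gt0//; apply: le_trans Hw _.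
  have := ler_wpM2l (ltW D0) DR'; rewrite expr2; have := mulr_gt0 D0 D0; lra.
have wD : enorm w <= D by exact: enorm_oproj.
have ww' : enorm (w - w') <= 16 / 1000 * Delta.
  have := opnorm_oproj_le w Hop; rewrite (oproj_id (mem_oproj W _)) -/w' => /le_trans; apply.
  have := ler_wpM2r (enorm_ge0 w) st; lra.
have w'1 : enorm w' <= D by exact: le_trans (enorm_oproj _ _) wD.
have w'2 : 91 / 100 * Delta <= enorm w'.
  have := ler_enormD (p - px0 - w) w; have := ler_enormD (w - w') w'.
  rewrite !subrK -/(eudist p px0) -/D; lra.
have w'0 : w' != 0 by apply/eqP => w'0; rewrite w'0 enorm0 in w'2; lra.
pose u := (enorm w')^-1 *: w'.
have uT : unit_sphere (That x) u.
  by split; [rewrite memvZ// mem_oproj|exact: enorm_unit].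
have [vs [_ vsT _ pmax] Hvs] := cov x xO.
have [v vvs uv] := pmax u uT.
have [y yO xy] := Hvs v vvs; exists y => //.
have w'u : enorm (w' - Delta *: u) <= 9 / 100 * Delta.
  rewrite (_ : w' - _ = (enorm w' - Delta) *: u); last first.
    rewrite scalerBl; congr (_ - _); rewrite /u scalerA mulfV ?scale1r//.
    by rewrite gt_eqF// enorm_gt0.
  by rewrite enormZ (enorm_unit w'0) mulr1 ler_norml; apply/andP; split; lra.
have uvD : enorm (Delta *: (u - v)) <= Delta / 32.
  rewrite enormZ gtr0_norm//; have := ler_wpM2l (ltW D0) uv; rewrite /eudist.
  have := ler_wpM2l (ltW D0) sa; lra.
have xM' : enorm (px0 - x) <= eta by rewrite -/(eudist px0 x) (eudist_nproj M0 cM).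
have yM : enorm (y - nproj M y) <= eta.
  by rewrite enorm_distrC -/(eudist _ y) (eudist_nproj M0 cM) gO.
rewrite /eudist in xy *.
(* In units of [Delta] the seven terms are at most 22/1000, 16/1000, 9/100, 1/32, 1/64, 7/10 and
   1/64, with sum below 95/100. *)
rewrite (_ : p - nproj M y = (p - px0 - w) + ((w - w') + ((w' - Delta *: u) +
  (Delta *: (u - v) + ((px0 - x) + ((x + Delta *: v - y) + (y - nproj M y))))))); last by vec.
do 6 (apply: le_trans (ler_enormD _ _) _; rewrite -lerBrDl).
lra.
Qed.

(** On [M], the open condition [f q < Delta] and the closed one [f q <= Delta] coincide, so by
    connectedness they hold everywhere; returning from projected to actual output points costs
    [eta]. *)
Lemma mp_output_cover p : M p -> dist_set p [set y | y \in mpO s] <= Delta + eta.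
Proof.
have [_ _ gO O0 _ _ _] := Is; rewrite Q0 /= in gO O0.
have D0 := Delta0.
pose PO := [seq nproj M x | x <- mpO s].
have PO0 : PO != [::] by rewrite /PO; case: (mpO s) O0.
have PO0' : [set y | y \in PO] !=set0.
  by case: (PO) PO0 => // y l _; exists y; rewrite /= mem_head.
pose f p := dist_set p [set y | y \in PO].
have cf : continuous f := continuous_dist_set PO0'.
have f_lt a q : f q < a -> exists2 x, x \in mpO s & eudist q (nproj M x) < a.
  by move=> /(dist_seq_lt PO0)[_ /mapP[x xO ->] qx]; exists x.
have f_le q : M q -> f q <= Delta -> f q < Delta.
  (* The slack up to [101 / 100 * Delta] yields an output point by a strict inequality, and
     [mp_output_closer] brings the distance back below [Delta]. *)
  move=> Mq fq; have /f_lt[x xO qx] : f q < 101 / 100 * Delta by lra.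
  have [y yO qy] := mp_output_closer Mq xO (ltW qx).
  have fy : f q <= eudist q (nproj M y) by rewrite eudistC; apply: dist_set_le; apply: map_f.
  by apply: le_lt_trans (le_trans fy qy) _; rewrite gtr_pMl// ltr_pdivrMr// mul1r ltr_nat.
have BE : M `&` [set q | f q < Delta] = M `&` [set q | f q <= Delta].
  by apply/seteqP; split=> q [Mq /= fq]; split=> //=; [exact: ltW|exact: f_le].
have [_ _ conM _ _] := Mclass.
have /(_ _ _ _) BM := conM (M `&` [set q | f q < Delta]).
have {}BM : M `&` [set q | f q < Delta] = M.
  apply: BM.
  - have [x xO] : exists x, x \in mpO s by case: (mpO s) O0 => // x l _; exists x; exact: mem_head.
    exists (nproj M x); split; first exact: nproj_in.
    apply: le_lt_trans D0; rewrite -(eudistxx (nproj M x)).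
    by apply: dist_set_le; apply: map_f.
  - exists [set q | f q < Delta] => //.
    rewrite (_ : mkset _ = f @^-1` [set t | t < Delta])//.
    by apply: open_comp (@open_lt R Delta) => y _; exact: cf.
  - exists [set q | f q <= Delta]; last exact: BE.
    rewrite (_ : mkset _ = f @^-1` [set t | t <= Delta])//.
    by apply: closed_comp (@closed_le R Delta) => y _; exact: cf.
move=> Mp; have [_ /f_lt[x xO px]] : (M `&` [set q | f q < Delta]) p by rewrite BM.
apply: le_trans (dist_set_le p (_ : [set y | y \in mpO s] x)) _ => //.
apply: le_trans (eudist_trans (nproj M x) x p) _.
by rewrite eudistC (eudist_nproj M0 cM) addrC lerD ?gO// eudistC ltW.
Qed.

End Output.
End Propagation.

Theorem theorem3p1 (R : realType) (n d : nat) (rchmin : R) (M : set 'rV[R]_n)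
  (x0 : 'rV[R]_n) (That : 'rV[R]_n -> {vspace 'rV[R]_n})
  (pihat : 'rV[R]_n -> 'rV[R]_n)
  (Delta delta alpha eta Lambda theta : R) :
  manifold_class d rchmin M ->
  (forall x, \dim (That x) = d) ->
  0 < Delta -> 0 < delta -> 0 < alpha < pi / 2 ->
  0 <= eta -> eta <= Lambda -> Lambda < rchmin -> 0 <= theta < pi / 2 ->
  dist_set x0 M <= eta ->
  (forall x, dist_set x M <= eta ->
     opnorm (fun v => oproj (tangent_space M (nproj M x)) v - oproj (vsset (That x)) v)
       <= sin theta) ->
  (forall x, dist_set x M <= Lambda -> eudist (nproj M x) (pihat x) <= eta) ->
  64 * eta <= Delta -> Delta <= rchmin / 24 ->
  Num.max (sin alpha) (sin theta) <= 1 / 64 ->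
  5 * Delta ^+ 2 / (8 * rchmin) + eta + Delta * sin theta <= Lambda ->
  3 * Delta / 10 <= delta <= 7 * Delta / 10 ->
  Acc (fun s' s => mp_step That pihat Delta delta alpha s s') (mp_init x0) /\
  (forall s, mp_reach That pihat Delta delta alpha (mp_init x0) s -> mpQ s = [::] ->
   [/\ ((mpN s)%:R%:E <= hausdorff d M * ((unit_ball_vol d * (delta / 32) ^+ d)^-1)%:E)%E,
       (forall x, x \in mpO s -> dist_set x M <= eta),
       (forall p, M p -> dist_set p [set y | y \in mpO s] <= Delta + eta),
       [set T | T \in mpT s] = [set That x | x in [set y | y \in mpO s]] &
       (forall x, x \in mpO s ->
          opnorm (fun v => oproj (tangent_space M (nproj M x)) v - oproj (vsset (That x)) v)
            <= sin theta)]).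
Proof.
move=> Mclass _ Delta0 _ _ eta0 _ _ _ x0M Hangle Hpihat etaD DR.
rewrite ge_max => /andP[sina sint] HL /andP[delta1 delta2].
split; first exact: (mp_terminates _ Mclass Delta0 x0M Hangle Hpihat etaD DR sint HL delta1).
move=> s reach Q0.
have Is := mp_inv_reach Mclass Delta0 x0M Hangle Hpihat etaD DR sint HL delta1 reach.
have [_ _ sdist _ _ sT _] := Is; rewrite Q0 /= in sdist.
split.
- exact: (mp_output_card Mclass Delta0 etaD DR delta1 delta2 Is Q0).
- exact: sdist.
- exact: (mp_output_cover Mclass Delta0 Hangle etaD DR sina sint delta1 delta2 Is Q0).
- rewrite sT; apply/seteqP; split=> [T /= /mapP[x xO ->]|T [x /= xO <-]]; first by exists x.
  exact: map_f.
- by move=> x xO; apply: Hangle; exact: sdist.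
Qed.
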